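(* Let $R$ be a left noetherian ring and let $M_1,\ldots,M_n$ be $R$-bimodules such that each $M_j$ is finitely generated as a left $R$-module. 1. If $R$ has finite left pure global dimension, then $\mathsf{K}(\mathsf{Inj}(M_1,\ldots,M_n))$ is compactly generated. 2. If every $M_j$ is flat as a right $R$-module, then $\mathsf{Inj}(M_1,\ldots,M_n)\subseteq\mathsf{Inj}\,R$ and $\mathsf{K}(\mathsf{Inj}(M_1,\ldots,M_n))$ is compactly generated (without any assumption on the pure global dimension of $R$). In particular (taking $n=1$ and $M_1=R$), $\mathsf{K}(\mathsf{Inj}\,R)$ is compactly generated.
   Context: Modules are left $R$-modules unless otherwise specified. $\mathsf{Inj}\,R$ is the class of injective left modules. $\mathsf{Inj}(M_1,\ldots,M_n)$ is the class of left modules $J$ for which there exist injective left modules $I_1,\ldots,I_n$ such that $J$ is a direct summand of $\operatorname{Hom}_R(M_1,I_1)\oplus\cdots\oplus\operatorname{Hom}_R(M_n,I_n)$ (where $\operatorname{Hom}_R$ is taken over the left structure of $M_j$ and the left $R$-action on it comes from the right structure of $M_j$). For a class $\mathbb{X}$ of modules closed under set-indexed coproducts and direct summands, $\mathsf{K}(\mathbb{X})$ is the triangulated category with objects the ($\mathbb{Z}$-indexed) chain complexes of modules from $\mathbb{X}$ and morphisms the chain maps modulo homotopy. A triangulated category $\mathsf{T}$ with set-indexed coproducts is compactly generated if there is a set $\mathcal{G}$ of compact objects (objects $C$ for which $\coprod_i\operatorname{Hom}_{\mathsf T}(C,X_i)\to\operatorname{Hom}_{\mathsf T}(C,\coprod_iX_i)$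 is always an isomorphism) such that, for all $X\in\mathsf{T}$, $\operatorname{Hom}_{\mathsf T}(G,X)=0$ for all $G\in\mathcal{G}$ implies $X\cong0$. A sequence $Y$ of modules is pure exact if $\operatorname{Hom}_R(N,Y)$ is exact for every finitely presented module $N$. A module $P$ is pure projective if $\operatorname{Hom}_R(P,-)$ preserves exactness of pure exact sequences. The left pure global dimension of $R$ is the least $d$ (or $\infty$) such that every left module $N$ has a pure exact sequence $0\to P_d\to\cdots\to P_0\to N\to0$ with all $P_i$ pure projective. *)

(* Defs.v *)
(* MathComp, with the classical axioms of mathcomp.classical.

   Modules are the left modules [lmodType R] over an associative unital ring
   [R : pzRingType] (the zero ring is not excluded); a right R-module is a left
   module over the converse ring R^c.

   Set-indexed families are indexed by a [choiceType]; every type is one by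
   classical choice.  The carriers of a [choiceType] and of an [lmodType R] live
   in the same universe, whereas the type [lmodType R] itself lives in a strictly
   larger one and cannot be made into a [choiceType].  So an index in
   [choiceType] is a set, as opposed to a proper class. *)
From HB Require Import structures.
From mathcomp Require Import all_boot all_order all_algebra.
From mathcomp Require Import all_classical.

Set Implicit Arguments.
Unset Strict Implicit.
Unset Printing Implicit Defensive.

Import GRing.Theory.
Local Open Scope classical_set_scope.
Local Open Scope ring_scope.
Local Open Scope quotient_scope.

(* The abelian group Hom_R(U, V). *)
Definition hom (R : pzRingType) (U V : lmodType R) : Type := {linear U -> V}.

Section HomZmodule.
Variables (R : pzRingType) (U V : lmodType R).
Implicit Types f g h : hom U V.

HB.instance Definition _ := gen_eqMixin (hom U V).
HB.instance Definition _ := gen_choiceMixin (hom U V).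

Lemma homP f g : f =1 g -> f = g.
Proof.
case: f g => f [[fa] [fs]] [g [[ga] [gs]]] /funext /= fg.
by move: ga gs; rewrite -fg => ga gs; do 2!f_equal; f_equal; exact: Prop_irrelevance.
Qed.

Let hom0 : hom U V := (\0 : {linear U -> V}).
Let homD f g : hom U V := (f \+ g : {linear U -> V}).
Let homN f : hom U V := (\- f : {linear U -> V}).

Let homDA : associative homD.
Proof. by move=> f g h; apply: homP => x /=; rewrite addrA. Qed.
Let homDC : commutative homD.
Proof. by move=> f g; apply: homP => x /=; rewrite addrC. Qed.
Let hom0D : left_id hom0 homD.
Proof. by move=> f; apply: homP => x /=; rewrite add0r. Qed.
Let homND : left_inverse hom0 homN homD.
Proof. by move=> f; apply: homP => x /=; rewrite addNr. Qed.

HB.instance Definition _ :=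
  GRing.isZmodule.Build (hom U V) homDA homDC hom0D homND.
End HomZmodule.

(* The product of a family of modules; for a finite index type this is the
   direct sum. *)
Definition product (R : pzRingType) (I : choiceType) (M : I -> lmodType R) :
  Type := forall i, M i.

Section Product.
Variables (R : pzRingType) (I : choiceType) (M : I -> lmodType R).
Local Notation P := (product M).

HB.instance Definition _ := gen_eqMixin P.
HB.instance Definition _ := gen_choiceMixin P.

Let add (x y : P) : P := fun i => x i + y i.
Let opp (x : P) : P := fun i => - x i.
Let zero : P := fun i => 0.
Let scale (r : R) (x : P) : P := fun i => r *: x i.

Let addA : associative add.
Proof. by move=> x y z; apply: functional_extensionality_dep => i; exact: addrA. Qed.
Let addC : commutative add.
Proof. by move=> x y; apply: functional_extensionality_dep => i; exact: addrC. Qed.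
Let add0 : left_id zero add.
Proof. by move=> x; apply: functional_extensionality_dep => i; exact: add0r. Qed.
Let addN : left_inverse zero opp add.
Proof. by move=> x; apply: functional_extensionality_dep => i; exact: addNr. Qed.

HB.instance Definition _ := GRing.isZmodule.Build P addA addC add0 addN.

Let scaleA a b (x : P) : scale a (scale b x) = scale (a * b) x.
Proof. by apply: functional_extensionality_dep => i; exact: scalerA. Qed.
Let scale1 : left_id 1 scale.
Proof. by move=> x; apply: functional_extensionality_dep => i; exact: scale1r. Qed.
Let scaleDr : right_distributive scale +%R.
Proof. by move=> a x y; apply: functional_extensionality_dep => i; exact: scalerDr. Qed.
Let scaleDl (x : P) : {morph scale^~ x : a b / a + b}.
Proof. by move=> a b; apply: functional_extensionality_dep => i; exact: scalerDl. Qed.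

HB.instance Definition _ :=
  GRing.Zmodule_isLmodule.Build R P scaleA scale1 scaleDr scaleDl.
End Product.

Record bimodule (R : pzRingType) := Bimodule {
  left_mod :> lmodType R;
  ract : left_mod -> R -> left_mod;
  ractA : forall m a b, ract (ract m a) b = ract m (a * b);
  ract1 : forall m, ract m 1 = m;
  ractDl : forall m m' a, ract (m + m') a = ract m a + ract m' a;
  ractDr : forall m a b, ract m (a + b) = ract m a + ract m b;
  ractZ : forall a m b, ract (a *: m) b = a *: ract m b
}.

(* The right R-module underlying a bimodule. *)
Definition right_mod (R : pzRingType) (M : bimodule R) : Type := left_mod M.

Section RightModule.
Variables (R : pzRingType) (M : bimodule R).
HB.instance Definition _ := GRing.Zmodule.on (right_mod M).

Let scale (a : R^c) (m : right_mod M) : right_mod M := ract (m : M) (a : R).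

Let scaleA a b m : scale a (scale b m) = scale (a * b) m.
Proof. exact: ractA. Qed.
Let scale1 : left_id 1 scale.
Proof. exact: ract1. Qed.
Let scaleDr : right_distributive scale +%R.
Proof. by move=> a m m'; exact: ractDl. Qed.
Let scaleDl m : {morph scale^~ m : a b / a + b}.
Proof. by move=> a b; exact: ractDr. Qed.

HB.instance Definition _ :=
  GRing.Zmodule_isLmodule.Build R^c (right_mod M) scaleA scale1 scaleDr scaleDl.
End RightModule.

(* Hom_R(M, I) for a bimodule M, with the left action (r f)(m) = f(m r). *)
Definition bihom (R : pzRingType) (M : bimodule R) (I : lmodType R) : Type :=
  hom M I.

Section BihomLmodule.
Variables (R : pzRingType) (M : bimodule R) (I : lmodType R).
HB.instance Definition _ := GRing.Zmodule.on (bihom M I).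

Section Scale.
Variables (r : R) (f : bihom M I).
Definition bihom_scale_fun (m : M) : I := f (ract m r).
Lemma bihom_scale_linear : linear bihom_scale_fun.
Proof.
by move=> a m m'; rewrite /bihom_scale_fun ractDl ractZ linearP.
Qed.
HB.instance Definition _ :=
  GRing.isLinear.Build R M I *:%R bihom_scale_fun bihom_scale_linear.
Definition bihom_scale : bihom M I := (bihom_scale_fun : {linear M -> I}).
End Scale.

Let scaleA a b f : bihom_scale a (bihom_scale b f) = bihom_scale (a * b) f.
Proof. by apply: homP => m /=; rewrite /bihom_scale_fun /= /bihom_scale_fun ractA. Qed.
Let scale1 : left_id 1 bihom_scale.
Proof. by move=> f; apply: homP => m /=; rewrite /bihom_scale_fun ract1. Qed.
Let scaleDr : right_distributive bihom_scale +%R.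
Proof. by move=> a f g; exact: homP. Qed.
Let scaleDl f : {morph bihom_scale^~ f : a b / a + b}.
Proof.
by move=> a b; apply: homP => m /=; rewrite /bihom_scale_fun ractDr linearD.
Qed.

HB.instance Definition _ :=
  GRing.Zmodule_isLmodule.Build R (bihom M I) scaleA scale1 scaleDr scaleDl.
End BihomLmodule.

Section Modules.
Variable R : pzRingType.

Definition left_ideal (I : set R) : Prop :=
  [/\ I 0, forall x y, I x -> I y -> I (x + y) & forall a x, I x -> I (a * x)].

Definition left_noetherian : Prop :=
  forall I : nat -> set R, (forall n, left_ideal (I n)) ->
    (forall n, I n `<=` I n.+1) -> exists N, forall n, (N <= n)%N -> I n = I N.

Definition finitely_generated (M : lmodType R) : Prop :=
  exists k, exists p : {linear 'rV[R]_k -> M}, forall m, exists x, p x = m.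

Definition finitely_presented (M : lmodType R) : Prop :=
  exists k l, exists (p : {linear 'rV[R]_k -> M})
                     (q : {linear 'rV[R]_l -> 'rV[R]_k}),
    (forall m, exists x, p x = m) /\
    (forall x, p x = 0 <-> exists y, q y = x).

Definition injective_module (J : lmodType R) : Prop :=
  forall (A B : lmodType R) (i : {linear A -> B}) (f : {linear A -> J}),
    injective i -> exists g : {linear B -> J}, forall a, g (i a) = f a.

Definition direct_summand (J P : lmodType R) : Prop :=
  exists (K : lmodType R) (e : {linear (J * K)%type -> P}), bijective e.

Definition Inj_of (n : nat) (M : 'I_n -> bimodule R) (J : lmodType R) : Prop :=
  exists I : 'I_n -> lmodType R, (forall j, injective_module (I j)) /\
    direct_summand J (product (fun j => bihom (M j) (I j) : lmodType R)).

Definition balanced (M : lmodType R^c) (A : lmodType R) (T : zmodType)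
    (b : M -> A -> T) : Prop :=
  [/\ forall m m' a, b (m + m') a = b m a + b m' a,
      forall m a a', b m (a + a') = b m a + b m a' &
      forall m (r : R) a, b ((r : R^c) *: m) a = b m (r *: a)].

Definition is_tensor (M : lmodType R^c) (A : lmodType R) (T : zmodType)
    (t : M -> A -> T) : Prop :=
  balanced t /\
  forall (U : zmodType) (b : M -> A -> U), balanced b ->
    (exists h : {additive T -> U}, forall m a, h (t m a) = b m a) /\
    (forall h h' : {additive T -> U},
       (forall m a, h (t m a) = b m a) -> (forall m a, h' (t m a) = b m a) ->
       h =1 h').

Definition flat (M : lmodType R^c) : Prop :=
  forall (A B : lmodType R) (f : {linear A -> B}), injective f ->
  forall (S T : zmodType) (s : M -> A -> S) (t : M -> B -> T),
    is_tensor s -> is_tensor t ->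
    forall h : {additive S -> T},
      (forall m a, h (s m a) = t m (f a)) -> injective h.

(* Finite sequences are extended by zero modules. *)
Record sequence := Sequence {
  term :> int -> lmodType R;
  diff : forall i, {linear term (i + 1) -> term i}
}.

(* Exactness of Hom_R(N, Y), at the term of degree i + 1 for every i. *)
Definition hom_exact (N : lmodType R) (Y : sequence) : Prop :=
  forall (i : int) (f : {linear N -> Y (i + 1)}),
    (forall x, diff Y i (f x) = 0) <->
    (exists g : {linear N -> Y (i + 1 + 1)},
       forall x, diff Y (i + 1) (g x) = f x).

Definition pure_exact (Y : sequence) : Prop :=
  forall N, finitely_presented N -> hom_exact N Y.

Definition pure_projective (P : lmodType R) : Prop :=
  forall Y, pure_exact Y -> hom_exact P Y.

(* A pure exact sequence 0 -> P_d -> ... -> P_0 -> N -> 0 with P_i in degree i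
   and N in degree -1. *)
Definition has_pure_resolution (d : nat) (N : lmodType R) : Prop :=
  exists Y : sequence,
    [/\ pure_exact Y,
        exists e : {linear Y (-1) -> N}, bijective e,
        forall i : int, 0 <= i <= d%:Z -> pure_projective (Y i) &
        forall i : int, (i < -1) || (d%:Z < i) -> forall x : Y i, x = 0].

Definition finite_pure_gldim : Prop :=
  exists d, forall N, has_pure_resolution d N.
End Modules.

Record preadditive := Preadditive {
  obj :> Type;
  mor : obj -> obj -> zmodType;
  idm : forall X, mor X X;
  comp : forall X Y Z, mor Y Z -> mor X Y -> mor X Z;
  compA : forall X Y Z W (h : mor Z W) (g : mor Y Z) (f : mor X Y),
    comp h (comp g f) = comp (comp h g) f;
  comp1m : forall X Y (f : mor X Y), comp (idm Y) f = f;
  compm1 : forall X Y (f : mor X Y), comp f (idm X) = f;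
  compDl : forall X Y Z (g g' : mor Y Z) (f : mor X Y),
    comp (g + g') f = comp g f + comp g' f;
  compDr : forall X Y Z (g : mor Y Z) (f f' : mor X Y),
    comp g (f + f') = comp g f + comp g f'
}.

Section CompactGeneration.
Variable T : preadditive.

Definition is_zero (X : T) : Prop :=
  (forall (Y : T) (f : mor X Y), f = 0) /\ (forall (Y : T) (f : mor Y X), f = 0).

Definition is_coproduct (I : choiceType) (X : I -> T) (S : T)
    (inj : forall i, mor (X i) S) : Prop :=
  forall (Y : T) (f : forall i, mor (X i) Y),
    exists! h : mor S Y, forall i, comp h (inj i) = f i.

Definition has_coproducts : Prop :=
  forall (I : choiceType) (X : I -> T),
    exists (S : T) (inj : forall i, mor (X i) S), is_coproduct inj.

(* The coproduct of the groups Hom(C, X_i) consists of the families with finite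
   support. *)
Definition compact_object (C : T) : Prop :=
  forall (I : choiceType) (X : I -> T) (S : T) (inj : forall i, mor (X i) S),
    is_coproduct inj ->
    set_bij [set f : forall i, mor C (X i) | finite_set [set i | f i != 0]]
            [set: mor C S]
            (fun f => \sum_(i \in [set: I]) comp (inj i) (f i)).

Definition compactly_generated : Prop :=
  has_coproducts /\
  exists (J : choiceType) (G : J -> T), (forall j, compact_object (G j)) /\
    forall X : T, (forall j (f : mor (G j) X), f = 0) -> is_zero X.
End CompactGeneration.

#[local] Obligation Tactic := idtac.

Section ChainMaps.
Variable R : pzRingType.

Record chain_map (X Y : sequence R) := ChainMap {
  cmap :> forall i, hom (X i) (Y i);
  cmapP : forall i x, cmap i (diff X i x) = diff Y i (cmap (i + 1) x)
}.

Section Zmodule.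
Variables X Y : sequence R.
HB.instance Definition _ := gen_eqMixin (chain_map X Y).
HB.instance Definition _ := gen_choiceMixin (chain_map X Y).

Lemma chain_mapP (f g : chain_map X Y) : (forall i, f i =1 g i) -> f = g.
Proof.
case: f g => f fP [g gP] /= fg.
have {fg} fg : f = g.
  by apply: functional_extensionality_dep => i; exact: homP (fg i).
by move: gP; rewrite -fg => gP; f_equal; exact: Prop_irrelevance.
Qed.

Program Definition chain_map0 : chain_map X Y := @ChainMap X Y (fun=> 0) _.
Next Obligation. by move=> i x /=; rewrite linear0. Qed.
Program Definition chain_mapD (f g : chain_map X Y) : chain_map X Y :=
  @ChainMap X Y (fun i => f i + g i) _.
Next Obligation. by move=> f g i x /=; rewrite !cmapP linearD. Qed.
Program Definition chain_mapN (f : chain_map X Y) : chain_map X Y :=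
  @ChainMap X Y (fun i => - f i) _.
Next Obligation. by move=> f i x /=; rewrite !cmapP linearN. Qed.

Let addA : associative chain_mapD.
Proof. by move=> f g h; apply: chain_mapP => i x /=; rewrite addrA. Qed.
Let addC : commutative chain_mapD.
Proof. by move=> f g; apply: chain_mapP => i x /=; rewrite addrC. Qed.
Let add0 : left_id chain_map0 chain_mapD.
Proof. by move=> f; apply: chain_mapP => i x /=; rewrite add0r. Qed.
Let addN : left_inverse chain_map0 chain_mapN chain_mapD.
Proof. by move=> f; apply: chain_mapP => i x /=; rewrite addNr. Qed.

HB.instance Definition _ :=
  GRing.isZmodule.Build (chain_map X Y) addA addC add0 addN.

(* Stated in degree i + 1, which covers all degrees. *)
Definition null_homotopic (f : chain_map X Y) : Prop :=
  exists s : forall i, {linear X i -> Y (i + 1)}, forall i x,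
    f (i + 1) x = diff Y (i + 1) (s (i + 1) x) + s i (diff X i x).

Definition null_homotopicb : {pred chain_map X Y} :=
  fun f => `[< null_homotopic f >].

Let null_homotopic_closed : zmod_closed null_homotopicb.
Proof.
split=> [|f g /asboolP[s sP] /asboolP[t tP]]; apply/asboolP.
  by exists (fun=> \0) => i x /=; rewrite linear0 addr0.
exists (fun i => (s i : hom _ _) - (t i : hom _ _)) => i x /=.
by rewrite sP tP linearB /= opprD addrACA.
Qed.

HB.instance Definition _ :=
  GRing.isZmodClosed.Build (chain_map X Y) null_homotopicb null_homotopic_closed.

Definition homotopy_class : zmodType := {ideal_quot null_homotopicb}.
End Zmodule.

Program Definition chain_id (X : sequence R) : chain_map X X :=
  @ChainMap X X (fun i => (idfun : {linear X i -> X i})) _.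
Next Obligation. by move=> X. Qed.
Program Definition chain_comp (X Y Z : sequence R)
    (g : chain_map Y Z) (f : chain_map X Y) : chain_map X Z :=
  @ChainMap X Z (fun i => (g i \o f i : {linear X i -> Z i})) _.
Next Obligation. by move=> X Y Z g f i x /=; rewrite !cmapP. Qed.
End ChainMaps.

Record complex (R : pzRingType) (C : lmodType R -> Prop) := Complex {
  cseq :> sequence R;
  complex_class : forall i, C (cseq i);
  complex_diff : forall i x, diff cseq i (diff cseq (i + 1) x) = 0
}.

Section HomotopyCategory.
Variables (R : pzRingType) (C : lmodType R -> Prop).
Implicit Types X Y Z W : complex C.

Definition homotopy_comp X Y Z (g : homotopy_class Y Z)
    (f : homotopy_class X Y) : homotopy_class X Z :=
  \pi_(homotopy_class X Z) (chain_comp (repr g) (repr f)).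

Lemma homotopyP X Y (f g : chain_map X Y) :
  \pi_(homotopy_class X Y) f = \pi_(homotopy_class X Y) g <->
  null_homotopic (f - g).
Proof.
split=> [/eqP|fg]; first by rewrite -Quotient.idealrBE => /asboolP.
by apply/eqP; rewrite -Quotient.idealrBE; apply/asboolP.
Qed.

Lemma homotopy_compE X Y Z (g : chain_map Y Z) (f : chain_map X Y) :
  homotopy_comp (\pi_(homotopy_class Y Z) g) (\pi_(homotopy_class X Y) f) =
  \pi_(homotopy_class X Z) (chain_comp g f).
Proof.
rewrite /homotopy_comp.
have /homotopyP[t tP] : \pi_(homotopy_class Y Z) (repr (\pi_(homotopy_class Y Z) g)) =
    \pi_(homotopy_class Y Z) g by rewrite reprK.
have /homotopyP[s sP] : \pi_(homotopy_class X Y) (repr (\pi_(homotopy_class X Y) f)) =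
    \pi_(homotopy_class X Y) f by rewrite reprK.
move: (repr _) (repr _) tP sP => f' g' tP sP; apply/homotopyP.
exists (fun i => ((t i \o f' i : {linear X i -> Z (i + 1)}) : hom _ _) +
                 ((g (i + 1) \o s i : {linear X i -> Z (i + 1)}) : hom _ _)).
move=> i x /=.
have -> : g' (i + 1) (f' (i + 1) x) - g (i + 1) (f (i + 1) x) =
  (g' - g) (i + 1) (f' (i + 1) x) + g (i + 1) ((f' - f) (i + 1) x).
  by rewrite /= linearB addrA subrK.
by rewrite tP sP !linearD !cmapP addrACA.
Qed.

Let homotopy_compA X Y Z W (h : homotopy_class Z W) (g : homotopy_class Y Z)
    (f : homotopy_class X Y) :
  homotopy_comp h (homotopy_comp g f) = homotopy_comp (homotopy_comp h g) f.
Proof.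
elim/quotW: h => h; elim/quotW: g => g; elim/quotW: f => f.
rewrite (homotopy_compE g f) (homotopy_compE h g) !homotopy_compE.
by congr (\pi_(_) _); apply: chain_mapP => i x.
Qed.

Let homotopy_comp1m X Y (f : homotopy_class X Y) :
  homotopy_comp (\pi_(homotopy_class Y Y) (chain_id Y)) f = f.
Proof.
elim/quotW: f => f; rewrite homotopy_compE.
by congr (\pi_(_) _); apply: chain_mapP => i x.
Qed.

Let homotopy_compm1 X Y (f : homotopy_class X Y) :
  homotopy_comp f (\pi_(homotopy_class X X) (chain_id X)) = f.
Proof.
elim/quotW: f => f; rewrite homotopy_compE.
by congr (\pi_(_) _); apply: chain_mapP => i x.
Qed.

Let homotopy_compDl X Y Z (g g' : homotopy_class Y Z) (f : homotopy_class X Y) :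
  homotopy_comp (g + g') f = homotopy_comp g f + homotopy_comp g' f.
Proof.
elim/quotW: g => g; elim/quotW: g' => g'; elim/quotW: f => f.
rewrite -raddfD (homotopy_compE g f) (homotopy_compE g' f) homotopy_compE -raddfD.
by congr (\pi_(_) _); apply: chain_mapP => i x.
Qed.

Let homotopy_compDr X Y Z (g : homotopy_class Y Z) (f f' : homotopy_class X Y) :
  homotopy_comp g (f + f') = homotopy_comp g f + homotopy_comp g f'.
Proof.
elim/quotW: g => g; elim/quotW: f => f; elim/quotW: f' => f'.
rewrite -raddfD (homotopy_compE g f) (homotopy_compE g f') homotopy_compE -raddfD.
by congr (\pi_(_) _); apply: chain_mapP => i x /=; rewrite linearD.
Qed.

(* K(C): complexes of modules from C and homotopy classes of chain maps. *)
Definition K : preadditive :=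
  @Preadditive (complex C) (fun X Y => homotopy_class X Y)
    (fun X => \pi_(homotopy_class X X) (chain_id X)) homotopy_comp
    homotopy_compA homotopy_comp1m homotopy_compm1
    homotopy_compDl homotopy_compDr.
End HomotopyCategory.

(* Main.v *)
From HB Require Import structures.
From mathcomp Require Import all_boot all_order all_algebra.
From mathcomp Require Import all_classical.
From mathcomp Require Import zify.
Require Import Defs.

Set Implicit Arguments.
Unset Strict Implicit.
Unset Printing Implicit Defensive.

Import Order.TTheory GRing.Theory Num.Theory.
Local Open Scope classical_set_scope.
Local Open Scope ring_scope.
Local Open Scope quotient_scope.

(** Let C be a class of modules closed under direct sums.  Call a map N -> J
    killing a subset L of N a preenvelope when J lies in C and every map from N
    to a module of C that kills L factors through it.  Iterating preenvelopes,
    the first one of a pair (R^k, L) and each next one of the last module and the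
    image of the map into it, gives a bounded above complex G of modules of C
    with a map R^k -> G, the coresolution being exact after Hom(-, J) for every J
    in C.  Hence, for every complex X in C, homotopy classes of chain maps G -> X
    are homology classes of Hom(R^k/L, X) ([resolution_lift],
    [resolution_null]).  As R^k is finitely generated and coproducts in K(C) are
    termwise direct sums, these G, one for each k, L and degree, are compact
    ([resolution_compact]).  If they detect nothing in X, then Hom(N, X) is exact
    for every finitely generated N; so K(C) is compactly generated as soon as
    this forces Hom(N, X) to be exact for every module N, since X is then
    contractible ([K_compactly_generated]).

    Preenvelopes come from an injective cogenerator E, the character module
    Hom_Z(R, Q/Z): every injective module is a retract of a power of E, so for
    Inj(M_1, ..., M_n) the map from N to the product of the Hom(M_j, E^S), where
    S is the set of the maps N -> Hom(M_j, E), those that do not kill L being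
    replaced by 0, is a preenvelope ([Inj_of_preenvelopes]).  Closure under
    direct sums is where R is noetherian and the M_j are finitely generated
    ([dsum_injective], [Inj_of_dsum]).

    The passage from finitely generated N to all N has two proofs.  When the
    terms of X are injective, it is Baer's argument: a partial solution g of
    d g = f is extended one element at a time, by Zorn's lemma
    ([injective_hom_exact]); this covers Inj R, and also Inj(M_1, ..., M_n) when
    the M_j are flat as right modules, Hom(M_j, I) being then injective
    ([flat_bihom_injective]).  In general X is pure exact and its terms are pure
    injective, because M_j (x) - keeps pure exact sequences exact
    ([bihom_pure_injective]).  So Hom(P, X) is exact for every pure projective P,
    and exactness of Hom(N, X) follows along a finite pure projective resolution
    of N ([pure_resolution_step]). *)

#[local] Obligation Tactic := idtac.

(** * Submodules, quotients and direct sums of modules *)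

Lemma dep_choice (I : Type) (A : I -> Type) (P : forall i, A i -> Prop) :
  (forall i, exists x, P i x) -> exists f : forall i, A i, forall i, P i (f i).
Proof. by move=> H; exists (fun i => sval (cid (H i))) => i; case: cid. Qed.

Section Linear.
Variable R : pzRingType.
Implicit Types U V W : lmodType R.

Definition lin U V (f : U -> V) (fP : linear f) : {linear U -> V} :=
  HB.pack f (GRing.isLinear.Build R U V *:%R f fP).

(** Builds linear maps from choices that are unique. *)
Lemma linear_choice U V (r : U -> V -> Prop) :
  (forall u, exists v, r u v) -> (forall u v w, r u v -> r u w -> v = w) ->
  (forall a u u' v v', r u v -> r u' v' -> r (a *: u + u') (a *: v + v')) ->
  exists g : {linear U -> V}, forall u, r u (g u).
Proof.
move=> /choice[g gP] uni rP.
have lg : linear g by move=> a u u'; apply: uni (gP _) (rP _ _ _ _ _ (gP _) (gP _)).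
by exists (lin lg).
Qed.

Record submodule V := Submodule {
  carrier :> V -> Prop;
  carrier0 : carrier 0;
  carrierP : forall a x y, carrier x -> carrier y -> carrier (a *: x + y) }.

Definition subpred V (S : submodule V) : {pred V} := fun x => `[< S x >].

Lemma subpred_closed V (S : submodule V) : submod_closed (subpred S).
Proof.
split; first by apply/asboolP; exact: carrier0.
by move=> a x y /asboolP Sx /asboolP Sy; apply/asboolP; exact: carrierP.
Qed.

HB.instance Definition _ V (S : submodule V) :=
  GRing.isSubmodClosed.Build R V (subpred S) (subpred_closed S).

Record sub_of V (S : submodule V) := SubOf { sval_of : V; _ : sval_of \in subpred S }.
HB.instance Definition _ V (S : submodule V) := [isSub for @sval_of V S].
HB.instance Definition _ V (S : submodule V) := [Choice of sub_of S by <:].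
HB.instance Definition _ V (S : submodule V) :=
  [SubChoice_isSubLmodule of sub_of S by <:].

Definition subval V (S : submodule V) (x : sub_of S) : V := val x.
Lemma subval_linear V (S : submodule V) : linear (@subval V S).
Proof. by []. Qed.
HB.instance Definition _ V (S : submodule V) :=
  GRing.isLinear.Build R (sub_of S) V *:%R (@subval V S) (@subval_linear V S).

Lemma subvalP V (S : submodule V) (x : sub_of S) : S (subval x).
Proof. exact: (asboolW (valP x)). Qed.

Lemma subval_inj V (S : submodule V) : injective (@subval V S).
Proof. exact: val_inj. Qed.

Lemma subval_ex V (S : submodule V) x : S x -> exists y : sub_of S, subval y = x.
Proof. by move=> Sx; exists (SubOf (asboolT Sx)). Qed.

Lemma corestrict U V (S : submodule V) (f : {linear U -> V}) :
  (forall u, S (f u)) -> exists g : {linear U -> sub_of S}, forall u, subval (g u) = f u.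
Proof.
move=> fS; have lg : linear (fun u => SubOf (asboolT (fS u))).
  by move=> a u v; apply: val_inj; rewrite /= linearP.
by exists (lin lg).
Qed.

Program Definition range_submodule U V (f : {linear U -> V}) : submodule V :=
  @Submodule V [set y | exists x, f x = y] _ _.
Next Obligation. by move=> U V f; exists 0; rewrite linear0. Qed.
Next Obligation.
by move=> U V f a _ _ [x <-] [y <-]; exists (a *: x + y); rewrite linearP.
Qed.

Program Definition ker_submodule U V (f : {linear U -> V}) : submodule U :=
  @Submodule U [set x | f x = 0] _ _.
Next Obligation. by move=> U V f; rewrite /= linear0. Qed.
Next Obligation.
by move=> U V f a x y /= fx fy; rewrite linearP fx fy scaler0 addr0.
Qed.

Lemma factor_surj U V W (p : {linear U -> V}) (g : {linear U -> W}) :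
  (forall v, exists u, p u = v) -> (forall u, p u = 0 -> g u = 0) ->
  exists h : {linear V -> W}, forall u, h (p u) = g u.
Proof.
move=> ps pg.
have [|||h hP] := @linear_choice V W (fun v w => exists2 u, p u = v & g u = w).
- by move=> v; have [u <-] := ps v; exists (g u), u.
- move=> _ v w [u <- <-] [u' uu' <-]; apply/eqP.
  by rewrite -subr_eq0 -linearB pg// linearB uu' subrr.
- move=> a _ _ _ _ [u <- <-] [u' <- <-].
  by exists (a *: u + u'); rewrite linearP.
exists h => u; have [u' uu' <-] := hP (p u); apply/eqP.
by rewrite -subr_eq0 -linearB pg// linearB uu' subrr.
Qed.

Definition quot_mod V (S : submodule V) : Type := {ideal_quot (subpred S)}.
HB.instance Definition _ V (S : submodule V) := GRing.Zmodule.on (quot_mod S).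

Section Quotient.
Variables (V : lmodType R) (S : submodule V).
Local Notation Q := (quot_mod S).
Definition quot_pi (x : V) : Q := \pi_({ideal_quot (subpred S)}) x.

Lemma quot_piP x y : quot_pi x = quot_pi y <-> S (x - y).
Proof.
split=> [/eqP|Sxy]; first by rewrite -Quotient.idealrBE => /asboolP.
by apply/eqP; rewrite -Quotient.idealrBE; apply/asboolP.
Qed.

Lemma quot_pi_surj (q : Q) : exists x, quot_pi x = q.
Proof. by exists (repr (q : {ideal_quot (subpred S)})); exact: reprK. Qed.

Lemma quot_piD x y : quot_pi (x + y) = quot_pi x + quot_pi y.
Proof. exact: raddfD. Qed.

Let scale a (q : Q) : Q := quot_pi (a *: sval (cid (quot_pi_surj q))).
Let scaleE a x : scale a (quot_pi x) = quot_pi (a *: x).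
Proof.
rewrite /scale; case: cid => y /= /quot_piP Syx; apply/quot_piP.
rewrite -scalerBr -[X in S X]addr0; apply: carrierP => //; exact: carrier0.
Qed.

Let scaleA a b q : scale a (scale b q) = scale (a * b) q.
Proof. by have [x <-] := quot_pi_surj q; rewrite !scaleE scalerA. Qed.
Let scale1 : left_id 1 scale.
Proof. by move=> q; have [x <-] := quot_pi_surj q; rewrite !scaleE scale1r. Qed.
Let scaleDr : right_distributive scale +%R.
Proof.
move=> a q q'; have [x <-] := quot_pi_surj q; have [y <-] := quot_pi_surj q'.
by rewrite -quot_piD !scaleE scalerDr quot_piD.
Qed.
Let scaleDl q : {morph scale^~ q : a b / a + b}.
Proof.
by move=> a b; have [x <-] := quot_pi_surj q; rewrite !scaleE scalerDl quot_piD.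
Qed.

HB.instance Definition _ :=
  GRing.Zmodule_isLmodule.Build R Q scaleA scale1 scaleDr scaleDl.

Lemma quot_pi_linear : linear quot_pi.
Proof. by move=> a x y; rewrite quot_piD -scaleE. Qed.
HB.instance Definition _ := GRing.isLinear.Build R V Q *:%R quot_pi quot_pi_linear.

Lemma quot_pi_eq0 x : quot_pi x = 0 <-> S x.
Proof. by rewrite -{2}[x]subr0 -quot_piP linear0. Qed.
End Quotient.

Section DirectSum.
Variables (I : choiceType) (M : I -> lmodType R).

Lemma productE a (x y : product M) i : (a *: x + y) i = a *: x i + y i.
Proof. by []. Qed.

Definition supp (x : product M) : set I := [set i | x i <> 0].

Program Definition fin_supp : submodule (product M) :=
  @Submodule (product M) (fun x => finite_set (supp x)) _ _.
Next Obligation. by apply: sub_finite_set (finite_set0 I) => i /=; apply. Qed.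
Next Obligation.
move=> a x y fx fy; apply: sub_finite_set (_ : finite_set (supp x `|` supp y)).
  move=> i /=; rewrite /supp /= -not_andP; apply: contra_not => -[xi yi].
  by rewrite productE xi yi scaler0 addr0.
by rewrite finite_setU.
Qed.

Definition dsum : lmodType R := sub_of fin_supp.

(** The direct sum is the submodule of the product on the families of finite
    support. *)
Definition coord i (x : dsum) : M i := subval x i.
Lemma coord_linear i : linear (coord i).
Proof. by []. Qed.
HB.instance Definition _ i :=
  GRing.isLinear.Build R dsum (M i) *:%R (coord i) (coord_linear i).

Lemma coordE i (x : dsum) : coord i x = subval x i.
Proof. by []. Qed.

Lemma coord_inj (x y : dsum) : (forall i, coord i x = coord i y) -> x = y.
Proof.
by move=> xy; apply: subval_inj; apply: functional_extensionality_dep => i; exact: xy.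
Qed.

Lemma coord_fin (x : dsum) : finite_set [set i | coord i x <> 0].
Proof. exact: subvalP x. Qed.

Lemma dsum_lift U (f : forall i, {linear U -> M i}) :
  (forall u, finite_set [set i | f i u <> 0]) ->
  exists g : {linear U -> dsum}, forall u i, coord i (g u) = f i u.
Proof.
move=> ffin; pose h u : product M := fun i => f i u.
have lh : linear h.
  by move=> a u v; apply: functional_extensionality_dep => i; exact: linearP.
have [g gP] := @corestrict _ _ fin_supp (lin lh) ffin.
by exists g => u i; rewrite coordE gP.
Qed.

Lemma dsum_inj_ex i : exists e : {linear M i -> dsum},
  (forall m, coord i (e m) = m) /\ (forall m j, j != i -> coord j (e m) = 0).
Proof.
pose h (m : M i) : product M := dfwith (T := M) (fun j => 0 : M j) i m.
have hi m : h m i = m by rewrite /h dfwithin.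
have hj m j : j != i -> h m j = 0 by move=> ji; rewrite /h dfwithout// eq_sym.
have lh : linear h.
  move=> a u v; apply: functional_extensionality_dep => j.
  rewrite productE; have [->|ji] := eqVneq j i.
    by rewrite !hi.
  by rewrite !hj// scaler0 addr0.
have [|g gP] := @corestrict _ _ fin_supp (lin lh).
  move=> u; apply: sub_finite_set (finite_set1 i) => j /= huj.
  by apply/eqP; apply: contra_notT huj => ji; exact: hj.
by exists g; split=> [m|m j ji]; rewrite coordE gP /= ?hi ?hj.
Qed.

Definition dinj i : {linear M i -> dsum} := sval (cid (dsum_inj_ex i)).

Lemma coord_dinj i m : coord i (dinj i m) = m.
Proof. by rewrite /dinj; case: cid => e /= []. Qed.

Lemma coord_dinj_neq i j m : j != i -> coord j (dinj i m) = 0.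
Proof. by rewrite /dinj; case: cid => e /= [_]; apply. Qed.

Lemma fsum_seq (V : zmodType) (F : I -> V) (r : seq I) :
  uniq r -> (forall i, F i <> 0 -> i \in r) ->
  \sum_(i \in [set: I]) F i = \sum_(i <- r) F i.
Proof.
move=> ur Fr; rewrite fsbig_supp; apply: fsbig_fwiden => //.
  by move=> i /= [_]; exact: Fr.
by move=> i /= [_ H]; apply: contrapT => Fi; apply: H.
Qed.

Lemma dsum_expand (x : dsum) (r : seq I) :
  uniq r -> (forall i, coord i x <> 0 -> i \in r) ->
  x = \sum_(i <- r) dinj i (coord i x).
Proof.
move=> ur xr; apply: coord_inj => j; rewrite linear_sum /=.
have [jr|jr] := boolP (j \in r).
  rewrite (bigD1_seq j)//= coord_dinj big1 ?addr0// => i ij.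
  by rewrite coord_dinj_neq// eq_sym.
rewrite big1_seq => [|i /= ir].
  by apply: contrapT => /xr; rewrite (negbTE jr).
by rewrite coord_dinj_neq//; apply: contraNneq jr => ->.
Qed.

Lemma dsum_supp_seq (x y : dsum) :
  exists r : seq I, [/\ uniq r, forall i, coord i x <> 0 -> i \in r &
                     forall i, coord i y <> 0 -> i \in r].
Proof.
have /finite_seqP[r rP] : finite_set ([set i | coord i x <> 0] `|` [set i | coord i y <> 0]).
  by rewrite finite_setU; split; exact: coord_fin.
exists (undup r); split; first exact: undup_uniq.
  move=> i xi; rewrite mem_undup.
  by have : [set` r] i by rewrite -rP; left.
move=> i yi; rewrite mem_undup.
by have : [set` r] i by rewrite -rP; right.
Qed.

Section Copair.
Variables (V : lmodType R) (f : forall i, {linear M i -> V}).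

(** The sum has finitely many nonzero terms, although it is indexed by all of
    I. *)
Definition copair (x : dsum) : V := \sum_(i \in [set: I]) f i (coord i x).

Lemma copair_linear : linear copair.
Proof.
move=> a x y; have [r [ur xr yr]] := dsum_supp_seq x y.
have fr (z : dsum) : (forall i, coord i z <> 0 -> i \in r) ->
    \sum_(i \in [set: I]) f i (coord i z) = \sum_(i <- r) f i (coord i z).
  move=> zr; apply: fsum_seq => // i fi; apply: zr; apply: contra_not fi => ->.
  by rewrite linear0.
rewrite /copair !fr//; last first.
  move=> i; rewrite linearP /=; apply: contra_notT => ir.
  have -> : coord i x = 0 by apply: contrapT => /xr; apply/negP.
  have -> : coord i y = 0 by apply: contrapT => /yr; apply/negP.
  by rewrite scaler0 addr0.
rewrite scaler_sumr -big_split /=; apply: eq_bigr => i _.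
by rewrite -!linearP.
Qed.

HB.instance Definition _ := GRing.isLinear.Build R dsum V *:%R copair copair_linear.

Lemma copair_seq (x : dsum) (r : seq I) :
  uniq r -> (forall i, coord i x <> 0 -> i \in r) ->
  copair x = \sum_(i <- r) f i (coord i x).
Proof.
move=> ur xr; apply: fsum_seq => // i fi; apply: xr; apply: contra_not fi => ->.
by rewrite linear0.
Qed.

Lemma copair_dinj i m : copair (dinj i m) = f i m.
Proof.
rewrite (@copair_seq _ [:: i])// ?big_seq1 ?coord_dinj// => j.
by apply: contra_notT; rewrite inE => ji; rewrite coord_dinj_neq.
Qed.
End Copair.

Lemma dsum_hom_ext (V : zmodType) (f g : {additive dsum -> V}) :
  (forall i m, f (dinj i m) = g (dinj i m)) -> f =1 g.
Proof.
move=> fg x; have [r [ur xr _]] := dsum_supp_seq x x.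
by rewrite (dsum_expand ur xr) !raddf_sum; apply: eq_bigr => i _.
Qed.
End DirectSum.
End Linear.

(** * Extension of linear maps by Zorn *)

Section Extension.
Variable R : pzRingType.
Implicit Types U V W J : lmodType R.

(** For a submodule of V x J, this says that it is the graph of a map defined
    on a submodule of V. *)
Definition functional V J (G : V * J -> Prop) := forall z, G (0, z) -> z = 0.

Lemma functionalP V J (G : submodule (V * J)%type) x z z' :
  functional G -> G (x, z) -> G (x, z') -> z = z'.
Proof.
move=> Gf Gz Gz'; apply/eqP; rewrite -subr_eq0; apply/eqP/Gf.
suff -> : (0, z - z') = (-1) *: (x, z') + (x, z) by apply: carrierP.
by rewrite scaleN1r; congr (_, _) => /=; rewrite ?addNr// addrC.
Qed.

Lemma functional_graph V J (G : submodule (V * J)%type) :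
  functional G -> (forall x, exists z, G (x, z)) ->
  exists g : {linear V -> J}, forall x, G (x, g x).
Proof.
move=> Gf Gt; apply: (linear_choice (r := fun x z => G (x, z))) => //.
  by move=> x z z'; exact: functionalP.
by move=> a x x' z z' Gz Gz'; have := carrierP a Gz Gz'.
Qed.

Program Definition adjoin V J (G : submodule (V * J)%type) (x : V) (w : J) :
    submodule (V * J)%type :=
  @Submodule R (V * J)%type
    (fun p => exists r : R, exists2 q, G q & p = r *: (x, w) + q) _ _.
Next Obligation.
move=> V J G x w /=; exists 0, 0; first exact: carrier0.
by rewrite scale0r addr0.
Qed.
Next Obligation.
move=> V J G x w a _ _ /= [r [q Gq ->]] [r' [q' Gq' ->]].
exists (a * r + r'), (a *: q + q'); first exact: carrierP.
by rewrite scalerDl scalerDr scalerA addrACA.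
Qed.

(** Zorn on the functional submodules G between G0 and P.  The hypothesis
    provides, for each x, a value w at x which is allowed by P and compatible
    with G on the multiples of x at which G is already defined, so a maximal G
    is defined everywhere.  P imposes equations on the extension, such as d g =
    f, besides linearity. *)
Lemma zorn_extension V J (P G0 : submodule (V * J)%type) :
  (forall p, G0 p -> P p) -> functional G0 ->
  (forall G : submodule (V * J)%type, (forall p, G0 p -> G p) ->
     (forall p, G p -> P p) -> functional G ->
     forall x, exists w, P (x, w) /\ forall r z, G (r *: x, z) -> z = r *: w) ->
  exists g : {linear V -> J}, (forall x, P (x, g x)) /\
    (forall x z, G0 (x, z) -> g x = z).
Proof.
move=> G0P G0f step.
pose good (S : submodule (V * J)%type) :=
  [/\ forall p, G0 p -> S p, forall p, S p -> P p & functional S].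
(* The union of the empty chain is empty, so the empty set is admitted. *)
pose goodset (X : set (V * J)%type) :=
  X = set0 \/ exists S : submodule (V * J)%type, good S /\ X = [set p | S p].
have [F FP Ftot|A [Agood Amax]] := @Zorn_bigcup _ goodset.
  have [Fe|] := pselect (forall X, F X -> X = set0).
    by left; rewrite -subset0 => p [X FX]; rewrite (Fe X FX).
  move=> /existsNP[X0 /not_implyP[FX0 X0n]].
  have [//|[S0 [[G0S0 _ _] X0E]]] := FP _ FX0.
  right; have c0 : (\bigcup_(X in F) X) 0.
    by exists X0 => //; rewrite X0E; exact: carrier0.
  have cP a p q : (\bigcup_(X in F) X) p -> (\bigcup_(X in F) X) q ->
      (\bigcup_(X in F) X) (a *: p + q).
    have aux X Y : F X -> F Y -> X `<=` Y -> forall p q b c, X p -> Y q ->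
        Y (b *: p + c *: q).
      move=> FX FY XY {}p {}q b c Xp Yq.
      have Yp := XY _ Xp.
      have [Y0|[S [_ YE]]] := FP _ FY; first by move: Yq; rewrite Y0.
      rewrite YE /= in Yp Yq *; rewrite -[c *: q]addr0.
      by do 2!apply: carrierP => //; exact: carrier0.
    move=> [X FX Xp] [Y FY Yq]; have [XY|YX] := Ftot _ _ FX FY.
      by exists Y => //; rewrite -[q]scale1r; apply: (aux X Y).
    by exists X => //; rewrite -[q]scale1r addrC; apply: (aux Y X).
  exists (Submodule c0 cP); split=> //; split=> /=.
  - by move=> p G0p; exists X0 => //; rewrite X0E; exact: G0S0.
  - move=> p [X FX Xp]; have [X_0|[S [[_ SP _] XE]]] := FP _ FX.
      by move: Xp; rewrite X_0.
    by apply: SP; move: Xp; rewrite XE.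
  - move=> z [X FX Xp]; have [X_0|[S [[_ _ Sf] XE]]] := FP _ FX.
      by move: Xp; rewrite X_0.
    by apply: Sf; move: Xp; rewrite XE.
have [A0|[S [[G0S SP Sf] AE]]] := Agood.
  exfalso; apply: (Amax [set p | G0 p]); last by right; exists G0.
  by rewrite A0; split=> // /(_ 0) H; apply: H; exact: carrier0.
(* By maximality S is defined at every x. *)
have St x : exists z, S (x, z).
  have [w [Pw wS]] := step S G0S SP Sf x; exists w.
  apply: contrapT => nS; apply: (Amax [set p | adjoin S x w p]).
    rewrite AE; split=> [p Sp|/(_ (x, w)) H].
      by exists 0, p => //; rewrite scale0r add0r.
    apply: nS; apply: H; exists 1, 0; first exact: carrier0.
    by rewrite scale1r addr0.
  right; exists (adjoin S x w); split=> //; split=> [p /G0S Sp|_ [r [q Sq ->]]|].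
  - by exists 0, p => //; rewrite scale0r add0r.
  - by apply: carrierP => //; exact: SP.
  move=> z [r [[v y] Sq [vE zE]]].
  have {}vE : v = (- r) *: x by apply/eqP; rewrite scaleNr -addr_eq0 addrC -vE.
  by move: Sq; rewrite vE => /wS yE; rewrite zE yE scaleNr subrr.
have [g gP] := functional_graph Sf St; exists g; split=> [x|x z G0z].
  exact: SP.
exact: functionalP Sf (gP x) (G0S _ G0z).
Qed.

(** Injectivity of J for partial maps given by their graphs. *)
Lemma extend_functional V J (G : submodule (V * J)%type) :
  injective_module J -> functional G ->
  exists g : {linear V -> J}, forall x z, G (x, z) -> g x = z.
Proof.
move=> Jinj Gf.
have l1 : linear (fun p : sub_of G => (subval p).1) by move=> a p q; rewrite linearP.
have l2 : linear (fun p : sub_of G => (subval p).2) by move=> a p q; rewrite linearP.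
have [|g gP] := Jinj _ _ (lin l1) (lin l2).
  move=> p q /= pq; apply: subval_inj.
  have := subvalP p; have := subvalP q; move: (subval p) (subval q) pq.
  move=> [x z] [x' z'] /= <- Gz Gz'; congr (_, _).
  exact: functionalP Gf Gz' Gz.
by exists g => x z /subval_ex[p pE]; have := gP p; rewrite /= pE.
Qed.

Program Definition zero_submodule V : submodule V := @Submodule R V (fun x => x = 0) _ _.
Next Obligation. by []. Qed.
Next Obligation. by move=> V a x y -> ->; rewrite scaler0 addr0. Qed.

Program Definition full_submodule V : submodule V := @Submodule R V (fun x => True) _ _.
Next Obligation. by []. Qed.
Next Obligation. by []. Qed.

Program Definition image_graph U V J (i : {linear U -> V}) (f : {linear U -> J}) :
    submodule (V * J)%type :=
  @Submodule R (V * J)%type (fun p => exists u, p = (i u, f u)) _ _.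
Next Obligation. by move=> U V J i f; exists 0; rewrite !linear0. Qed.
Next Obligation.
by move=> U V J i f a _ _ [u ->] [v ->]; exists (a *: u + v); rewrite !linearP.
Qed.

(** Here L is the set of pairs of a scalar r carrying a new element x into the
    domain of a partial map and of its value at r x; w becomes the value at x.
    *)
Lemma baer J :
  (forall (L : submodule (R^o * J)%type), functional L ->
    exists w, forall r z, L (r, z) -> z = (r : R) *: w) -> injective_module J.
Proof.
move=> JB A B i f iinj.
have [||G _ _ Gf x|g [_ gP]] :=
    @zorn_extension B J (full_submodule _) (image_graph i f).
- by [].
- move=> z [u [iu zE]]; rewrite zE.
  by rewrite (iinj u 0) ?linear0.
- pose c (p : R^o * J) := G ((p.1 : R) *: x, p.2).
  have c0 : c 0 by rewrite /c /= scale0r; exact: carrier0.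
  have cP a p q : c p -> c q -> c (a *: p + q).
    by move=> cp cq; rewrite /c [X in G (X, _)](_ : _ = a *: ((p.1 : R) *: x) + (q.1 : R) *: x);
      [exact: (@carrierP _ _ G a (_, _) (_, _) cp cq) | by rewrite scalerA -scalerDl].
  have [|w wP] := JB (Submodule c0 cP).
    by move=> z; rewrite /= /c /= scale0r; exact: Gf.
  by exists w; split=> // r z Gz; exact: wP.
by exists g => a; apply: gP; exists a.
Qed.

End Extension.

(** * The injective cogenerator of abelian groups *)

Section RationalsModuloIntegers.

Lemma additive_int_linear (V W : lmodType int) (f : V -> W) :
  {morph f : x y / x + y} -> linear f.
Proof.
move=> fD a x y; have f0 : f 0 = 0 by apply: (addrI (f 0)); rewrite -fD !addr0.
have fN z : f (- z) = - f z.
  by apply: (addrI (f z)); rewrite -fD !subrr.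
have fn n z : f (z *+ n) = f z *+ n.
  by elim: n => [|n IH]; rewrite ?mulr0n// !mulrS fD IH.
rewrite fD; congr (_ + _).
rewrite -[a in LHS]intz -[a in RHS]intz !scaler_int; case: a => n.
  by rewrite -!pmulrn fn.
by rewrite !NegzE !mulrNz fN -!pmulrn fn.
Qed.

Program Definition int_rat : submodule (zmodule rat) :=
  @Submodule int (zmodule rat) (fun q => (q : rat) \is a Num.int) _ _.
Next Obligation. exact: rpred0. Qed.
Next Obligation.
by move=> a x y; rewrite scalezrE => xi yi; apply: rpredD => //; apply: rpredMz.
Qed.

(** Q/Z, as a module over the integers. *)
Definition QZ : lmodType int := quot_mod int_rat.
Definition toQZ (q : rat) : QZ := quot_pi int_rat (q : zmodule rat).

Lemma toQZ_eq0 q : toQZ q = 0 <-> q \is a Num.int.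
Proof. exact: quot_pi_eq0. Qed.

Lemma toQZZ (k : int) q : k *: toQZ q = toQZ (q *~ k).
Proof. by rewrite /toQZ -linearZ. Qed.

Lemma toQZ_surj z : exists q, toQZ q = z.
Proof. by have [q <-] := quot_pi_surj z; exists q. Qed.

(** Baer: a nonzero ideal of the integers is generated by its least positive
    element n+1, and the value q mod Z of the given map there is n+1 times
    q/(n+1) mod Z. *)
Lemma QZ_injective : injective_module QZ.
Proof.
apply: baer => L Lf.
have LZ (k r : int) z : L (r, z) -> L (k * r, k *: z).
  by move=> Lrz; have := carrierP k Lrz (carrier0 L); rewrite addr0.
have LB r z r' z' : L (r, z) -> L (r', z') -> L (r - r', z - z').
  by move=> H H'; have := carrierP (-1) H' H; rewrite scaleN1r addrC.
have [none|] := pselect (forall n z, L (Posz n.+1, z) -> False).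
  exists 0 => -[[|n]|n] z Lz; rewrite scaler0.
  - exact: Lf.
  - by case: (none n z).
  - by case: (none n ((-1) *: z)); have := LZ (-1) _ _ Lz; rewrite NegzE mulN1r opprK.
move=> /existsNP[n0 /existsNP[z1 /not_implyP[L1 _]]].
have exn : exists n, `[< exists z, L (Posz n.+1, z) >].
  by exists n0; apply/asboolP; exists z1.
have [n /asboolP[z0 L0] nmin] := ex_minnP exn.
have [q qE] := toQZ_surj z0.
exists (toQZ (q / n.+1%:R)) => m z Lz.
have [|m0] := eqVneq (modz m n.+1) 0.
  move=> mE; have mE' : m = (divz m n.+1) * n.+1 by rewrite {1}(divz_eq m n.+1) mE addr0.
  have := LZ (divz m n.+1) _ _ L0; rewrite -mE' => Lz'.
  rewrite (functionalP Lf Lz Lz') -qE !toQZZ [in RHS]mE'; congr toQZ.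
  by rewrite [(_ %/ _)%Z * _]mulrC mulrzA -pmulrn -[_ *+ _]mulr_natr mulfVK// pnatr_eq0.
exfalso.
have Lr := LB _ _ _ _ Lz (LZ (divz m n.+1) _ _ L0).
have mE : m - divz m n.+1 * n.+1 = modz m n.+1 by rewrite {1}(divz_eq m n.+1) addrC addKr.
rewrite mE in Lr.
have := ltz_pmod m (ltn0Sn n : (0 < n.+1 :> int)%R).
have := modz_ge0 m (isT : n.+1 != 0 :> int).
case: (modz m n.+1) m0 Lr => // -[|k]// _ Lr _ kn.
have /nmin : `[< exists z, L (Posz k.+1, z) >] by apply/asboolP; eexists; exact: Lr.
by move: kn; rewrite ltz_nat ltnS => kn nk; have := leq_ltn_trans nk kn; rewrite ltnn.
Qed.

Lemma inv_nat_nonint n : ~ (1 / n.+2%:R : rat) \is a Num.int.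
Proof.
move=> /intrP[m mE]; have {mE} : 1 = (m * n.+2)%:~R :> rat.
  by rewrite intrM -mE pmulrn mulfVK// ?mul1r // pnatr_eq0.
move=> /(intr_inj (x1 := 1)) mE; have : (n.+2 %| 1)%Z by apply/dvdzP; exists m; exact: mE.
by rewrite dvdz1.
Qed.

(** Send x to 1/m mod Z when x has finite order m, and to 1/2 mod Z when its
    order is infinite; this is well defined on the multiples of x and extends
    because Q/Z is injective. *)
Lemma QZ_cogenerates (V : zmodType) (x : V) : x <> 0 ->
  exists f : {linear zmodule V -> QZ}, f x <> 0.
Proof.
move=> x0.
have [q [qx qn]] : exists q : rat, (forall k : int, x *~ k = 0 -> q *~ k \is a Num.int) /\
   ~ q \is a Num.int.
  have [none|] := pselect (forall n, x *+ n.+1 = 0 -> False).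
    exists (1 / 2%:R); split.
      move=> [[|n]|n] xn; first by rewrite mulr0z rpred0.
        by case: (none n).
      by case: (none n); apply/eqP; rewrite -oppr_eq0; apply/eqP; rewrite -[RHS]xn NegzE mulrNz.
    exact: inv_nat_nonint.
  move=> /existsNP[n0 xn0].
  have exn : exists n, x *+ n.+1 == 0 by exists n0; apply/eqP; apply: contrapT => H; apply: xn0.
  have [n /eqP xn nmin] := ex_minnP exn.
  exists (1 / n.+1%:R); split=> [k xk|].
    have : x *~ (modz k n.+1) = 0.
      move: xk; rewrite {1}(divz_eq k n.+1) mulrzDr mulrC mulrzA.
      by rewrite (xn : x *~ Posz n.+1 = 0) mul0rz add0r.
    have := ltz_pmod k (ltn0Sn n : (0 < n.+1 :> int)%R).
    have := modz_ge0 k (isT : n.+1 != 0 :> int).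
    rewrite {4}(divz_eq k n.+1); case: (modz k n.+1) => // -[|m] _ kn xm.
      by rewrite addr0 [(_ %/ _)%Z * _]mulrC mulrzA -pmulrn -[_ *+ _]mulr_natr mulfVK ?pnatr_eq0// rpredMz// rpred1.
    have /nmin : x *+ m.+1 == 0 by apply/eqP.
    by move: kn; rewrite ltz_nat ltnS => kn nk; have := leq_ltn_trans nk kn; rewrite ltnn.
  case: n xn {nmin} => [|n] xn; first by case: x0; rewrite -[x]mulr1n.
  exact: inv_nat_nonint.
pose gen : zmodule V * QZ := (x, toQZ q).
pose G p := exists k : int, p = k *: gen.
have G0 : G 0 by exists 0; rewrite scale0r.
have GP a p p' : G p -> G p' -> G (a *: p + p').
  by move=> [k ->] [k' ->]; exists (a * k + k'); rewrite scalerDl scalerA.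
have [z [k [/esym xk ->]]|f fP] := extend_functional QZ_injective (G := Submodule G0 GP).
  by rewrite toQZZ; apply/toQZ_eq0; exact: qx.
exists f => fx; apply: qn; apply/toQZ_eq0; rewrite -fx; apply/esym/fP.
by exists 1; rewrite scale1r.
Qed.

End RationalsModuloIntegers.

(** * Character modules and injective modules *)

Section CharacterModule.
Variable R : pzRingType.

(** Hom_Z(R, Q/Z), on which R acts by (a f)(s) = f(s a). *)
Definition char_mod : Type := hom (zmodule R : lmodType int) QZ.
HB.instance Definition _ := GRing.Zmodule.on char_mod.

Section Scale.
Variables (a : R) (f : char_mod).
Lemma char_scale_linear : linear (fun s : zmodule R => f ((s : R) * a)).
Proof. by apply: additive_int_linear => s t; rewrite mulrDl linearD. Qed.
Definition char_scale : char_mod := lin char_scale_linear.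
End Scale.

Let scaleA a b f : char_scale a (char_scale b f) = char_scale (a * b) f.
Proof. by apply: homP => s /=; rewrite mulrA. Qed.
Let scale1 : left_id 1 char_scale.
Proof. by move=> f; apply: homP => s /=; rewrite mulr1. Qed.
Let scaleDr : right_distributive char_scale +%R.
Proof. by move=> a f g; apply: homP. Qed.
Let scaleDl f : {morph char_scale^~ f : a b / a + b}.
Proof. by move=> a b; apply: homP => s /=; rewrite mulrDr linearD. Qed.

HB.instance Definition _ :=
  GRing.Zmodule_isLmodule.Build R char_mod scaleA scale1 scaleDr scaleDl.

(** The adjunction between R-linear maps V -> Hom_Z(R, Q/Z) and additive maps V
    -> Q/Z, the latter recovered by evaluation at 1.  It transports injectivity
    and cogeneration from Q/Z. *)
Lemma char_adjoint (V : lmodType R) (f : {linear (zmodule V : lmodType int) -> QZ}) :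
  exists g : {linear V -> (char_mod : lmodType R)},
    forall v s, g v s = f ((s : R) *: (v : V)).
Proof.
have lv v : linear (fun s : zmodule R => f ((s : R) *: (v : V))).
  by apply: additive_int_linear => s t; rewrite scalerDl linearD.
have lg : linear (fun v : V => lin (lv v) : char_mod).
  move=> a u v; apply: homP => s.
  by rewrite /= scalerDr linearD scalerA.
by exists (lin lg).
Qed.

Lemma char_mod_injective : injective_module (char_mod : lmodType R).
Proof.
move=> A B i f iinj.
have lf : linear (fun a : zmodule A => f a (1 : R)).
  by apply: additive_int_linear => x y; rewrite linearD.
have li : linear (i : zmodule A -> zmodule B).
  by apply: additive_int_linear => x y; rewrite linearD.
have [//|h hP] := QZ_injective (i := lin li) (lin lf).
have [g gP] := char_adjoint h; exists g => a; apply: homP => s.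
by rewrite gP -linearZ; have /= -> := hP (s *: a); rewrite linearZ /= mul1r.
Qed.

Lemma char_mod_cogenerates (V : lmodType R) (x : V) : x <> 0 ->
  exists f : {linear V -> (char_mod : lmodType R)}, f x <> 0.
Proof.
move=> /QZ_cogenerates[f fx]; have [g gP] := char_adjoint f; exists g => gx.
by apply: fx; have := gP x 1; rewrite gx scale1r.
Qed.

End CharacterModule.

Section InjectiveModules.
Variable R : pzRingType.

Definition retract (J P : lmodType R) := exists (i : {linear J -> P}) (r : {linear P -> J}),
  cancel i r.

(** The complement is the kernel of the retraction. *)
Lemma retract_summand J P : retract J P -> direct_summand J P.
Proof.
move=> [i [r ir]]; exists (sub_of (ker_submodule r)).
have le : linear (fun p : (J * sub_of (ker_submodule r))%type => i p.1 + subval p.2).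
  by move=> a p q; rewrite !linearP /= scalerDr addrACA.
exists (lin le).
have lk : linear (fun x => x - i (r x)).
  by move=> a x y; rewrite (linearP r) (linearP i) scalerBr opprD addrACA.
have [|k kP] := corestrict (S := ker_submodule r) (f := lin lk).
  by move=> x /=; rewrite linearB ir subrr.
exists (fun x => (r x, k x)) => [[x y]|x] /=; last by rewrite kP addrC subrK.
have ry : r (subval y) = 0 := subvalP y.
congr (_, _); first by rewrite linearD ir ry addr0.
by apply: subval_inj; rewrite kP /= linearD ir ry addr0 addrC addKr.
Qed.

Lemma summand_retract J P : direct_summand J P -> retract J P.
Proof.
move=> [K [e [g eg ge]]].
have li : linear (fun x : J => e (x, 0)).
  by move=> a x y; rewrite -linearP; congr (e (_, _)); rewrite /= scaler0 addr0.
have lr : linear (fun p => (g p).1).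
  move=> a p q; rewrite -{1}[p]ge -{1}[q]ge -linearP eg //.
by exists (lin li), (lin lr) => x /=; rewrite eg.
Qed.

Lemma retract_injective J P : retract J P -> injective_module P -> injective_module J.
Proof.
move=> [i [r ir]] Pinj A B u f uinj.
have [g gP] := Pinj _ _ u (i \o f : {linear A -> P}) uinj.
by exists (r \o g : {linear B -> J}) => a /=; rewrite gP /= ir.
Qed.

Lemma product_lift (I : choiceType) (M : I -> lmodType R) (U : lmodType R)
    (f : forall i, {linear U -> M i}) :
  exists g : {linear U -> (product M : lmodType R)}, forall u i, g u i = f i u.
Proof.
have lg : linear (fun u => (fun i => f i u) : product M).
  by move=> a u v; apply: functional_extensionality_dep => i; exact: linearP.
by exists (lin lg).
Qed.

Definition proj (I : choiceType) (M : I -> lmodType R) i (x : product M) : M i := x i.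
Lemma proj_linear (I : choiceType) (M : I -> lmodType R) i : linear (@proj I M i).
Proof. by []. Qed.
HB.instance Definition _ (I : choiceType) (M : I -> lmodType R) i :=
  GRing.isLinear.Build R (product M) (M i) *:%R (@proj I M i) (@proj_linear I M i).

Lemma product_injective (I : choiceType) (M : I -> lmodType R) :
  (forall i, injective_module (M i)) -> injective_module (product M).
Proof.
move=> Minj A B u f uinj.
have /dep_choice[g gP] : forall i, exists g : {linear B -> M i}, forall a, g (u a) = f a i.
  by move=> i; exact: (Minj i _ _ u (proj i \o f : {linear A -> M i}) uinj).
have [h hP] := product_lift g; exists h => a.
by apply: functional_extensionality_dep => i; rewrite hP gP.
Qed.

(** The evaluation map into the power of E indexed by all maps J -> E is
    injective because E is a cogenerator, and it splits because J is injective.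
    *)
Lemma injective_retract (J : lmodType R) : injective_module J ->
  exists (i : {linear J -> (product (fun _ : hom J (char_mod R) => char_mod R : lmodType R)
                             : lmodType R)})
         (r : {linear (product (fun _ : hom J (char_mod R) => char_mod R : lmodType R)
                             : lmodType R) -> J}),
    (forall x f, i x f = f x) /\ cancel i r.
Proof.
move=> Jinj.
have [i iP] := product_lift (fun f : hom J (char_mod R) => f : {linear J -> _}).
exists i; have [|r rP] := Jinj _ _ i idfun.
  move=> x y xy; apply/eqP; rewrite -subr_eq0; apply/eqP; apply: contrapT.
  move=> /char_mod_cogenerates[f]; rewrite linearB => fxy; apply: fxy.
  by apply/eqP; rewrite subr_eq0 -(iP x f) -(iP y f) xy.
by exists r.
Qed.

End InjectiveModules.

(** * Compact objects of preadditive categories and descending recursion *)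

Section Preadditive.
Variable T : preadditive.

Lemma comp0m (X Y Z : T) (f : mor X Y) : comp (0 : mor Y Z) f = 0.
Proof. by apply: (addrI (comp 0 f)); rewrite -compDl !addr0. Qed.
Lemma compm0 (X Y Z : T) (f : mor Y Z) : comp f (0 : mor X Y) = 0.
Proof. by apply: (addrI (comp f 0)); rewrite -compDr !addr0. Qed.

Lemma comp_sumr (X Y Z : T) (g : mor Y Z) (I : Type) (r : seq I) (F : I -> mor X Y) :
  comp g (\sum_(i <- r) F i) = \sum_(i <- r) comp g (F i).
Proof.
by elim: r => [|i r IH]; rewrite ?big_nil ?compm0// !big_cons compDr IH.
Qed.

Lemma comp_fsumr (X Y Z : T) (g : mor Y Z) (I : choiceType) (F : I -> mor X Y) :
  finite_set [set i | F i <> 0] ->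
  comp g (\sum_(i \in [set: I]) F i) = \sum_(i \in [set: I]) comp g (F i).
Proof.
move=> /finite_seqP[r rE]; have Fr i : F i <> 0 -> i \in undup r.
  by move=> Fi; rewrite mem_undup; have : [set` r] i by rewrite -rE.
rewrite !(@fsum_seq _ _ _ (undup r)) ?undup_uniq// ?comp_sumr// => i gF.
by apply: Fr; apply: contra_not gF => ->; rewrite compm0.
Qed.

Lemma coproduct_hom_ext (I : choiceType) (X : I -> T) (S : T)
    (inj : forall i, mor (X i) S) (Y : T) (g h : mor S Y) :
  is_coproduct inj -> (forall i, comp g (inj i) = comp h (inj i)) -> g = h.
Proof.
move=> coprod gh; have [k [_ kuni]] := coprod Y (fun i => comp h (inj i)).
by rewrite -(kuni g gh) -(kuni h (fun=> erefl)).
Qed.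

Lemma comp_inj_fin (I : choiceType) (C : T) (X : I -> T) (S : T)
    (inj : forall i, mor (X i) S) (f : forall i, mor C (X i)) :
  finite_set [set i | f i != 0] -> finite_set [set i | comp (inj i) (f i) <> 0].
Proof.
by apply: sub_finite_set => i /=; apply: contra_not_neq => ->; rewrite compm0.
Qed.

(** A coproduct comes with projections, since the homs of the category have
    zeros; they give injectivity of the comparison map for every coproduct.
    Surjectivity for one coproduct of each family transfers along the
    isomorphism with any other. *)
Lemma compact_criterion (C : T) :
  (forall (I : choiceType) (X : I -> T), exists S (inj : forall i, mor (X i) S),
     is_coproduct inj /\ forall g : mor C S, exists f : forall i, mor C (X i),
       finite_set [set i | f i != 0] /\ g = \sum_(i \in [set: I]) comp (inj i) (f i)) ->
  compact_object C.
Proof.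
move=> crit I X S inj coprod; split=> //.
- move=> f f' /set_mem ff /set_mem ff' eqf.
  apply: functional_extensionality_dep => i.
  have [p [pP _]] := coprod (X i) (dfwith (T := fun j => mor (X j) (X i)) (fun=> 0) i (idm _)).
  have key (h : forall i, mor C (X i)) : finite_set [set i | h i != 0] ->
      comp p (\sum_(i \in [set: I]) comp (inj i) (h i)) = h i.
    move=> fh; rewrite comp_fsumr; last exact: comp_inj_fin.
    rewrite (@fsum_seq _ _ _ [:: i])// ?big_seq1 ?compA ?pP ?dfwithin ?comp1m// => j.
    apply: contra_notT; rewrite inE => ji.
    by rewrite compA pP dfwithout ?comp0m// eq_sym.
  by rewrite -(key f)// -(key f')// eqf.
- move=> g _; have [S' [inj' [coprod' surj]]] := crit I X.
  have [h [hP _]] := coprod S' inj'; have [h' [hP' _]] := coprod' S inj.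
  have [f [ff fE]] := surj (comp h g); exists f => //.
  have -> : g = comp h' (comp h g).
    rewrite compA (_ : comp h' h = idm S) ?comp1m//.
    by apply: coproduct_hom_ext coprod _ => i; rewrite -compA hP hP' comp1m.
  rewrite fE comp_fsumr; last exact: comp_inj_fin.
  by apply: eq_fsbigr => i _; rewrite compA hP'.
Qed.

Lemma zero_of_idm (X : T) : idm X = 0 -> is_zero X.
Proof.
move=> id0; split=> Y f; first by rewrite -[f]compm1 id0 compm0.
by rewrite -[f]comp1m id0 comp0m.
Qed.
End Preadditive.

(** Recursion on decreasing integers: in degrees at least p the family is
    given, and below p each value is chosen from the previous one, Q being the
    invariant that makes the choice possible.  The fuel of the auxiliary
    fixpoint at i is the distance from i to p, so that the value at i is by
    definition one step from the value at i + 1. *)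
Lemma descend (A : int -> Type) (Q : forall i, A i -> Prop)
    (P : forall i : int, A (i + 1) -> A i -> Prop) (p : int) (a : forall i, A i) :
  Q p (a p) -> (forall i : int, p <= i -> P i (a (i + 1)) (a i)) ->
  (forall (i : int) x, i < p -> Q (i + 1) x -> exists y, Q i y /\ P i x y) ->
  exists f : forall i, A i, (forall i, p <= i -> f i = a i) /\ forall i, P i (f (i + 1)) (f i).
Proof.
move=> Qp Pge Plt.
have /dep_choice[step stepP] : forall u : {i : int & A (i + 1)}, exists y : A (tag u),
    tag u < p -> Q (tag u + 1) (tagged u) -> Q (tag u) y /\ P (tag u) (tagged u) y.
  move=> [i x] /=; have [ip|] := boolP (i < p); last by exists (a i).
  have [Qx|] := pselect (Q (i + 1) x); last by exists (a i).
  by have [y yP] := Plt i x ip Qx; exists y.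
pose fix F (m : nat) (i : int) {struct m} : A i :=
  if m is m'.+1 then
    if i < p then step (Tagged (fun i => A (i + 1)) (F m' (i + 1))) else a i
  else a i.
pose f i := F (absz (p - i)%R) i.
have fge (i : int) : p <= i -> f i = a i.
  rewrite /f; case: (absz _) => [|m]//= pi; by rewrite ltNge pi.
have flt (i : int) : i < p -> f i = step (Tagged (fun i => A (i + 1)) (f (i + 1))).
  move=> ip; rewrite /f (_ : absz (p - i)%R = (absz (p - (i + 1))%R).+1) /= ?ip//; lia.
have fQ (n : nat) (i : int) : p - i = n%:Z -> Q i (f i).
  elim: n i => [|n IH] i pin.
    by have ip : i = p; [lia | rewrite ip fge].
  have ip : i < p by lia.
  rewrite flt//; apply: (proj1 (stepP (Tagged (fun i => A (i + 1)) (f (i + 1))) ip _)).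
  apply: IH => /=; lia.
exists f; split=> [|i]; first exact: fge.
have [ip|pi] := ltP i p; last by rewrite !fge//; [exact: Pge | lia].
rewrite [in X in P _ _ X]flt//.
apply: (proj2 (stepP (Tagged (fun i => A (i + 1)) (f (i + 1))) ip _)) => /=.
apply: (fQ (absz (p - (i + 1))%R)); lia.
Qed.

(** * Resolutions by preenvelopes *)

Section Resolution.
Variables (R : pzRingType) (C : lmodType R -> Prop).

Definition kills (N J : lmodType R) (L : set N) (g : {linear N -> J}) :=
  forall x, L x -> g x = 0.

(** Working relatively to a subset L of N amounts to taking preenvelopes of the
    quotient of N by the submodule that L generates, without forming it. *)
Definition has_preenvelopes := forall (N : lmodType R) (L : set N),
  exists (J : lmodType R) (e : {linear N -> J}), [/\ C J, kills L e &
    forall (J' : lmodType R) (g : {linear N -> J'}), C J' -> kills L g ->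
      exists h : {linear J -> J'}, forall x, g x = h (e x)].

(** An iterated preenvelope of the pair (N, L), the first module being put in
    degree p and the complex being zero above p.  In degree i, [res_sub] is the
    set of elements that a map out of this term must kill in order to factor
    through the next term: the image of N in degree p, the image of the
    differential below p. *)
Record resolution (N : lmodType R) (L : set N) (p : int) := Resolution {
  res :> complex C;
  res_unit : {linear N -> res p};
  res_sub : forall i, set (res i);
  res_kills : forall (i : int) (w : res (i + 1)), res_sub w -> diff res i w = 0;
  res_bound : forall (i : int) x, res_sub (diff res i x);
  res_sub_lt : forall (i : int) w, i < p -> res_sub w -> exists x, diff res i x = w;
  res_factor : forall (i : int) (J : lmodType R) (g : {linear res (i + 1) -> J}),
    C J -> kills (@res_sub (i + 1)) g ->
    exists h : {linear res i -> J}, forall x, g x = h (diff res i x);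
  res_unit_sub : forall w, res_sub w <-> exists x, res_unit x = w;
  res_unit_kills : kills L res_unit;
  res_unit_factor : forall (J : lmodType R) (g : {linear N -> J}),
    C J -> kills L g -> exists h : {linear res p -> J}, forall x, g x = h (res_unit x);
  res_gt : forall (i : int) (x : res i), p < i -> x = 0
}.

(** Each stage of the descending recursion is a module with the set of elements
    to be killed next; the differentials are extracted afterwards. *)
Lemma resolution_exists (Z : lmodType R) (N : lmodType R) (L : set N) (p : int) :
  C Z -> (forall z : Z, z = 0) -> has_preenvelopes -> inhabited (resolution L p).
Proof.
move=> CZ Z0 env.
pose stage := {J : lmodType R & set J}.
have [J0 [e0 [CJ0 e0L e0P]]] := env N L.
(* The recursion starts with zero modules above p. *)
pose base (i : int) : stage := if i == p then existT _ J0 [set w | exists x, e0 x = w]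
                               else existT _ Z setT.
pose P (i : int) (x y : stage) := C (projT1 y) /\
  exists d : {linear projT1 x -> projT1 y},
  [/\ kills (projT2 x) d, forall u, projT2 y (d u),
      i < p -> forall w, projT2 y w -> exists u, d u = w &
      forall (J : lmodType R) (g : {linear projT1 x -> J}),
        C J -> kills (projT2 x) g ->
        exists h : {linear projT1 y -> J}, forall u, g u = h (d u)].
have Cbase i : C (projT1 (base i)) by rewrite /base; case: eqP.
have base0 i : projT2 (base i) 0.
  by rewrite /base; case: eqP => //= _; exists 0; rewrite linear0.
have base_gt (i : int) (x : projT1 (base i)) : p < i -> x = 0.
  move: x; rewrite /base; case: eqP => [->|_ x _]; first by rewrite ltxx.
  exact: Z0.
have Pge (i : int) : p <= i -> P i (base (i + 1)) (base i).
  move=> pi; split; first exact: Cbase.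
  have b0 (u : projT1 (base (i + 1))) : u = 0 by apply: base_gt; lia.
  exists \0; split=> //; first by move=> ip; lia.
  by move=> J g _ _; exists \0 => u; rewrite (b0 u) linear0.
have [|f [fge fP]] := @descend (fun=> stage) (fun _ _ => True) P p base I Pge.
  move=> i [x Lx] ip _; have [J [e [CJ eL eP]]] := env x Lx.
  exists (existT _ J [set w | exists u, e u = w]); split=> //; split=> //=.
  by exists e; split=> //= u; exists u.
have fp : f p = base p by exact: fge.
have [eta [etaE etaL etaP]] : exists eta : {linear N -> projT1 (f p)},
   [/\ forall w, projT2 (f p) w <-> exists x, eta x = w, kills L eta &
     forall (J : lmodType R) (g : {linear N -> J}),
    C J -> kills L g -> exists h : {linear projT1 (f p) -> J}, forall x, g x = h (eta x)].
  by rewrite fp /base eqxx; exists e0.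
have /dep_choice[d dP] := fun i => (fP i).2.
pose S := Sequence (term := fun i => projT1 (f i)) d.
have SC i : C (S i) by exact: (fP i).1.
have Sd i x : diff S i (diff S (i + 1) x) = 0.
  have [kd _ _ _] := dP i; have [_ bd _ _] := dP (i + 1); apply: kd; exact: bd.
apply: inhabits; apply: (@Resolution N L p (Complex SC Sd) eta (fun i => projT2 (f i))) => //.
- by move=> i w; have [kd _ _ _] := dP i; exact: kd.
- by move=> i; have [_ bd _ _] := dP i; exact: bd.
- by move=> i w ip; have [_ _ ld _] := dP i; exact: ld.
- by move=> i J g; have [_ _ _ ud] := dP i; exact: ud.
- move=> i x pi; move: x; rewrite /= fge; last exact: ltW.
  by move=> x; exact: base_gt.
Qed.

(** The differential out of degree i is reached by writing i as a successor j +
    1; quantifying over j lets the statement be made in every degree i. *)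
Definition cycle (X : sequence R) (i : int) (x : X i) : Prop :=
  forall (j : int) (e : i = j + 1), diff X j (ecast k (X k) e x) = 0.

Lemma cycleS (X : sequence R) (j : int) (x : X (j + 1)) :
  cycle x <-> diff X j x = 0.
Proof.
split=> [/(_ j erefl)//|dx j' e].
have ej : j = j' by exact: addIr e.
by subst j'; rewrite (eq_axiomK e).
Qed.

Lemma cycle_diff (X : complex C) (i : int) (x : X (i + 1)) : cycle (diff X i x).
Proof. by move=> j e; subst i; exact: complex_diff. Qed.

Section Universal.
Variables (N : lmodType R) (L : set N) (q : int) (G : resolution L (q + 1)).
Variable X : complex C.

(** The components are chosen downwards from degree q + 1, each by the
    factorization property of the preenvelope.  The invariant is that F maps
    the elements to be killed to cycles. *)
Lemma resolution_lift (phi : {linear N -> X (q + 1)}) :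
  kills L phi -> (forall x, diff X q (phi x) = 0) ->
  exists F : chain_map G X, forall x, F (q + 1) (res_unit G x) = phi x.
Proof.
move=> phiL dphi.
have [h hP] := res_unit_factor G (complex_class X (q + 1)) phiL.
pose base i : hom (G i) (X i) :=
  dfwith (T := fun i => hom (G i) (X i)) (fun=> 0) (q + 1) (h : hom _ _) i.
pose Q i (F : hom (G i) (X i)) := forall w, res_sub w -> cycle (F w).
pose P i (F : hom (G (i + 1)) (X (i + 1))) (F' : hom (G i) (X i)) :=
  forall x, F' (diff G i x) = diff X i (F x).
have [|i qi x|i F iq FQ|F [Fge FP]] := @descend (fun i => hom (G i) (X i)) Q P (q + 1) base.
- move=> w /res_unit_sub[x <-]; apply/cycleS; rewrite /base dfwithin -hP.
  exact: dphi.
- have -> : x = 0 by apply: (res_gt (r := G)); lia.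
  by rewrite !linear0.
- have [|F' F'P] := @res_factor _ _ _ G i _ (diff X i \o F : {linear _ -> _}) (complex_class X i).
    by move=> w Gw /=; apply/cycleS; exact: FQ.
  exists F'; split=> [w Gw|x]; last by rewrite -F'P.
  have [x <-] := res_sub_lt iq Gw; rewrite -F'P; exact: cycle_diff.
exists (ChainMap FP) => x /=; rewrite Fge// /base dfwithin; exact/esym/hP.
Qed.

(** The null homotopy s is chosen downwards as well: F - d s has to kill the
    elements to be killed in degree i + 1, which is the invariant F = d s on
    them. *)
Lemma resolution_null (F : chain_map G X) (g : {linear N -> X (q + 1 + 1)}) :
  kills L g -> (forall x, F (q + 1) (res_unit G x) = diff X (q + 1) (g x)) ->
  null_homotopic F.
Proof.
move=> gL Fg.
have [h hP] := res_unit_factor G (complex_class X (q + 1 + 1)) gL.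
pose base i : hom (G i) (X (i + 1)) :=
  dfwith (T := fun i => hom (G i) (X (i + 1))) (fun=> 0) (q + 1) (h : hom _ _) i.
pose Q i (s : hom (G i) (X (i + 1))) := forall w, res_sub w -> F i w = diff X i (s w).
pose P i (s : hom (G (i + 1)) (X (i + 1 + 1))) (s' : hom (G i) (X (i + 1))) :=
  forall x, F (i + 1) x = diff X (i + 1) (s x) + s' (diff G i x).
have [|i qi x|i s iq sQ|s [_ sP]] :=
    @descend (fun i => hom (G i) (X (i + 1))) Q P (q + 1) base.
- by move=> w /res_unit_sub[x <-]; rewrite /base dfwithin Fg hP.
- have -> : x = 0 by apply: (res_gt (r := G)); lia.
  by rewrite !linear0 addr0.
- pose k : hom (G (i + 1)) (X (i + 1)) :=
    F (i + 1) - ((diff X (i + 1) \o s : {linear _ -> _}) : hom _ _).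
  have [|s' s'P] := @res_factor _ _ _ G i _ k (complex_class X (i + 1)).
    by move=> w Gw; rewrite /k /= sQ// subrr.
  exists s'; split=> [w Gw|x]; last by rewrite -s'P /k /= addrCA subrr addr0.
  have [x <-] := res_sub_lt iq Gw.
  by rewrite -s'P /k /= linearB /= complex_diff subr0 cmapP.
by exists s.
Qed.

Lemma res_unit_cycle x : diff G q (res_unit G x) = 0.
Proof. by apply: res_kills; apply/res_unit_sub; exists x. Qed.

Lemma resolution_detect :
  (forall F : chain_map G X, null_homotopic F) ->
  forall phi : {linear N -> X (q + 1)}, kills L phi ->
  (forall x, diff X q (phi x) = 0) ->
  exists g : {linear N -> X (q + 1 + 1)}, kills L g /\
    forall x, phi x = diff X (q + 1) (g x).
Proof.
move=> null phi phiL dphi; have [F FP] := resolution_lift phiL dphi.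
have [s sP] := null F; exists (s (q + 1) \o res_unit G : {linear _ -> _}); split=> [x Lx|x] /=.
  by rewrite (res_unit_kills G) ?linear0.
by rewrite -FP sP res_unit_cycle linear0 addr0.
Qed.
End Universal.
End Resolution.

(** * Compact generation of K(C) for a class with preenvelopes *)

Section DirectSumComplex.
Variables (R : pzRingType).

Section DsumMap.
Variables (I : choiceType) (M M' : I -> lmodType R) (f : forall i, {linear M i -> M' i}).

Lemma dsum_map_ex : exists g : {linear dsum M -> dsum M'},
  forall x i, coord i (g x) = f i (coord i x).
Proof.
apply: (dsum_lift (f := fun i => (f i \o coord i : {linear _ -> _}))) => x.
apply: sub_finite_set (coord_fin x) => i /=; apply: contra_not => ->.
by rewrite linear0.
Qed.

Definition dsum_map : {linear dsum M -> dsum M'} := sval (cid dsum_map_ex).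

Lemma coord_dsum_map x i : coord i (dsum_map x) = f i (coord i x).
Proof. exact: (svalP (cid dsum_map_ex)). Qed.

Lemma dsum_map_dinj i m : dsum_map (dinj M i m) = dinj M' i (f i m).
Proof.
apply: coord_inj => j; rewrite coord_dsum_map; have [->|ji] := eqVneq j i.
  by rewrite !coord_dinj.
by rewrite !coord_dinj_neq// linear0.
Qed.
End DsumMap.

(** The supports of the images of finitely many generators contain all the
    others. *)
Lemma fg_support (I : choiceType) (M : I -> lmodType R) (N : lmodType R)
    (f : {linear N -> dsum M}) : finitely_generated N ->
  exists2 r : seq I, uniq r & forall x i, coord i (f x) <> 0 -> i \in r.
Proof.
move=> [k [p pP]].
have /finite_seqP[r rE] : finite_set
    (\bigcup_(j in [set: 'I_k]) [set i | coord i (f (p (delta_mx 0 j))) <> 0]).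
  by apply: bigcup_finite => // j _; exact: coord_fin.
exists (undup r) => [|x i]; first exact: undup_uniq.
apply: contra_notT; rewrite mem_undup => ir.
have [u <-] := pP x; rewrite (row_sum_delta u) !linear_sum big1//= => j _.
rewrite !linearZ /=; suff -> : coord i (f (p (delta_mx 0 j))) = 0 by rewrite scaler0.
apply: contrapT => c; move/negP: ir; apply.
by have : [set` r] i by rewrite -rE; exists j.
Qed.

Variable C : lmodType R -> Prop.
Hypothesis C_dsum : forall (I : choiceType) (M : I -> lmodType R),
  (forall i, C (M i)) -> C (dsum M).

Section Coproduct.
Variables (I : choiceType) (X : I -> complex C).

Definition dsum_seq : sequence R :=
  Sequence (fun d => dsum_map (fun i => diff (X i) d)).

Lemma dsum_seq_diff d x : diff dsum_seq d (diff dsum_seq (d + 1) x) = 0.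
Proof.
by apply: coord_inj => i; rewrite !coord_dsum_map complex_diff linear0.
Qed.

Definition dsum_complex : complex C :=
  @Complex R C dsum_seq (fun d => C_dsum (fun i => complex_class (X i) d)) dsum_seq_diff.

Lemma dsum_inj_chain i d x :
  dinj (fun i => X i d) i (diff (X i) d x) =
  diff dsum_complex d (dinj (fun i => X i (d + 1)) i x).
Proof. by rewrite [RHS]dsum_map_dinj. Qed.

Definition dsum_inj i : chain_map (X i) dsum_complex :=
  @ChainMap R (X i) dsum_complex (fun d => dinj (fun i => X i d) i : {linear _ -> _})
    (@dsum_inj_chain i).

Lemma dsum_complex_hom (Y : complex C) (F : forall i, chain_map (X i) Y) :
  exists G : chain_map dsum_complex Y, forall i, chain_comp G (dsum_inj i) = F i.
Proof.
have Fd d x : copair (fun i => F i d : {linear _ -> _}) (diff dsum_complex d x) =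
    diff Y d (copair (fun i => F i (d + 1) : {linear _ -> _}) x).
  pose u : {linear dsum_complex (d + 1) -> Y d} :=
    copair (fun i => F i d : {linear _ -> _}) \o diff dsum_complex d.
  pose v : {linear dsum_complex (d + 1) -> Y d} :=
    diff Y d \o copair (fun i => F i (d + 1) : {linear _ -> _}).
  apply: (dsum_hom_ext (f := u) (g := v)) => i m.
  by rewrite /u /v /= -dsum_inj_chain !copair_dinj cmapP.
exists (@ChainMap R dsum_complex Y
  (fun d => copair (fun i => F i d : {linear _ -> _}) : {linear _ -> _}) Fd).
by move=> i; apply: chain_mapP => d x; exact: copair_dinj.
Qed.

Lemma dsum_complex_null (Y : complex C) (F : chain_map dsum_complex Y) :
  (forall i, null_homotopic (chain_comp F (dsum_inj i))) -> null_homotopic F.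
Proof.
move=> /dep_choice[s sP]; exists (fun d => copair (fun i => s i d)) => d x.
pose v : {linear dsum_complex (d + 1) -> Y (d + 1)} :=
  ((diff Y (d + 1) \o copair (fun i => s i (d + 1)) : {linear _ -> _}) : hom _ _) +
  ((copair (fun i => s i d) \o diff dsum_complex d : {linear _ -> _}) : hom _ _).
apply: (dsum_hom_ext (f := F (d + 1)) (g := v)) => i m.
by rewrite /v /= -dsum_inj_chain !copair_dinj -sP.
Qed.

(** A homotopy class out of the direct sum is determined by its restrictions,
    because null homotopies of these restrictions add up. *)
Lemma dsum_complex_coproduct :
  @is_coproduct (K C) I X dsum_complex (fun i => \pi_(homotopy_class _ _) (dsum_inj i)).
Proof.
move=> Y f; have [G GP] := dsum_complex_hom (fun i => repr (f i)).
exists (\pi_(homotopy_class _ _) G); split=> [i|h hP].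
  by rewrite /= homotopy_compE GP reprK.
move: hP; elim/quotW: h => H hP; apply/homotopyP/dsum_complex_null => i.
have -> : chain_comp (G - H) (dsum_inj i) =
    chain_comp G (dsum_inj i) - chain_comp H (dsum_inj i) by exact: chain_mapP.
by apply/homotopyP; rewrite GP reprK -hP /= homotopy_compE.
Qed.
End Coproduct.

Lemma chain_map_sumE (X Y : sequence R) (I : Type) (r : seq I)
    (F : I -> chain_map X Y) d x :
  (\sum_(i <- r) F i) d x = \sum_(i <- r) F i d x.
Proof. by elim: r => [|i r IH]; rewrite ?big_nil// !big_cons /= IH. Qed.

(** For F : G -> X with X a direct sum, the image of R^k in X has finite
    support.  Lifting its coordinates separately gives finitely many maps G ->
    X_i whose sum agrees with F on R^k, hence is homotopic to F. *)
Lemma resolution_compact k (L : set 'rV[R]_k) q (G : resolution C L (q + 1)) :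
  @compact_object (K C) G.
Proof.
apply: compact_criterion => I X; exists (dsum_complex X).
exists (fun i => \pi_(homotopy_class _ _) (dsum_inj X i)).
split; first exact: dsum_complex_coproduct.
move=> g; elim/quotW: g => F.
pose phi : {linear 'rV[R]_k -> dsum (fun i => X i (q + 1))} :=
  F (q + 1) \o res_unit G.
have [|r ur rP] := fg_support phi.
  by exists k, idfun => x; exists x.
have /dep_choice[H HP] : forall i, exists H : chain_map G (X i),
    forall x, H (q + 1) (res_unit G x) = coord i (phi x).
  move=> i.
  have [||H HP] := @resolution_lift _ _ _ _ _ G (X i) (coord i \o phi).
  - by move=> x Lx; rewrite /phi /= (res_unit_kills G)// !linear0.
  - move=> x; have := cmapP F (res_unit G x).
    rewrite res_unit_cycle linear0 => /esym dF.
    have := coord_dsum_map (fun i => diff (X i) q) (phi x) i.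
    by rewrite [dsum_map _ _]dF linear0.
  by exists H.
pose f i : homotopy_class G (X i) :=
  if i \in r then \pi_(homotopy_class _ _) (H i) else 0.
exists f; split.
  apply: sub_finite_set (finite_seq r) => i /=; rewrite /f.
  by case: (i \in r) => //=; rewrite eqxx.
rewrite (@fsum_seq _ _ _ r)//; last first.
  by move=> i; apply: contra_notT; rewrite /f => /negbTE ->; exact: (@compm0 (K C)).
rewrite big_seq (eq_bigr (fun i => \pi_(homotopy_class G (dsum_complex X))
    (chain_comp (dsum_inj X i) (H i)))); last first.
  by move=> i ir; rewrite /f ir /= homotopy_compE.
rewrite -big_seq -raddf_sum; apply/homotopyP.
apply: (resolution_null (g := \0)) => // x.
rewrite linear0 /= chain_map_sumE; apply/eqP; rewrite subr_eq0; apply/eqP.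
rewrite [LHS](dsum_expand ur (rP x)); apply: eq_bigr => i _.
by rewrite /= HP.
Qed.

(** Exactness of Hom(R^k/L, X), for all k and L. *)
Definition hom_fg_exact (X : sequence R) := forall k (L : set 'rV[R]_k) (q : int)
    (phi : {linear 'rV[R]_k -> X (q + 1)}),
  kills L phi -> (forall x, diff X q (phi x) = 0) ->
  exists g : {linear 'rV[R]_k -> X (q + 1 + 1)},
    kills L g /\ forall x, phi x = diff X (q + 1) (g x).

Program Definition cycle_submodule (X : sequence R) (i : int) : submodule (X i) :=
  @Submodule R (X i) (@cycle R X i) _ _.
Next Obligation. by move=> X i j e; subst i; rewrite linear0. Qed.
Next Obligation.
move=> X i a x y cx cy j e; move: (cx j e) (cy j e); subst i => /= dx dy.
by rewrite linearP dx dy scaler0 addr0.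
Qed.

(** Exactness of Hom(Z_i, X), for Z_i the module of cycles of degree i, gives
    sections s_i : Z_i -> X_(i+1) of the differentials; s_i (1 - s_(i-1) d) is
    a contraction. *)
Lemma contractible_zero (X : complex C) :
  (forall N, hom_exact N X) -> @is_zero (K C) X.
Proof.
move=> Xex; apply: zero_of_idm; rewrite /= -(raddf0 (\pi_(homotopy_class X X))).
apply/homotopyP.
pose Z i := cycle_submodule X i.
have pred (i : int) : exists j, i = j + 1 by exists (i - 1); rewrite subrK.
have /dep_choice[s sP] : forall i : int, exists s : {linear sub_of (Z i) -> X (i + 1)},
    forall z, diff X i (s z) = subval z.
  move=> i; have [j ->] := pred i.
  apply: (Xex _ j (@subval _ _ (Z (j + 1)) : {linear _ -> _})).1 => z.
  exact: (cycleS _).1 (subvalP z).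
have /dep_choice[c cP] : forall i : int, exists c : {linear X (i + 1) -> sub_of (Z i)},
    forall x, subval (c x) = diff X i x.
  by move=> i; apply: corestrict => x; exact: cycle_diff.
(* r = 1 - s d, with d the differential out of degree i *)
have /dep_choice[r rP] : forall i : int, exists r : {linear X i -> sub_of (Z i)},
    forall j (e : j + 1 = i) (x : X (j + 1)),
    subval (r (ecast k (X k) e x)) = ecast k (X k) e (x - s j (c j x)).
  move=> i; have [j ->] := pred i.
  have [|r rP] := corestrict (S := Z (j + 1)) (f := (idfun : hom (X (j + 1)) (X (j + 1)))
      - ((s j \o c j : {linear _ -> _}) : hom _ _)).
    by move=> x; apply/cycleS; rewrite linearB /= sP cP subrr.
  exists r => j' e x; have ej : j' = j by exact: addIr e.
  by subst j'; rewrite (eq_axiomK e) rP.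
exists (fun i => s i \o r i : {linear _ -> _}) => i x /=.
rewrite sP (rP (i + 1) i erefl) subr0 /=.
suff -> : r i (diff X i x) = c i x by rewrite subrK.
have [j ij] := pred i; subst i.
have c0 : c j (diff X (j + 1) x) = 0.
  by apply: subval_inj; rewrite cP complex_diff linear0.
by apply: subval_inj; rewrite (rP (j + 1) j erefl) cP /= c0 linear0 subr0.
Qed.

(** The generators are the resolutions of all pairs (R^k, L), in all degrees.
    *)
Theorem K_compactly_generated :
  has_preenvelopes C ->
  (forall X : complex C, hom_fg_exact X -> forall N, hom_exact N X) ->
  compactly_generated (K C).
Proof.
move=> env Cex; split.
  move=> I X; exists (dsum_complex X).
  by exists (fun i => \pi_(homotopy_class _ _) (dsum_inj X i)); exact: dsum_complex_coproduct.
(* the sum of the empty family *)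
pose Z := dsum (fun v : void => match v with end : lmodType R).
have CZ : C Z by apply: C_dsum => -[].
have Z0 (z : Z) : z = 0 by apply: coord_inj => -[].
have /dep_choice[G _] : forall j : {k : nat & set 'rV[R]_k} * int,
    exists G : resolution C (tagged j.1) (j.2 + 1), True.
  by move=> j; have [G] := resolution_exists (tagged j.1) (j.2 + 1) CZ Z0 env; exists G.
exists ({k : nat & set 'rV[R]_k} * int)%type, (fun j => res (G j) : K C); split.
  by move=> j; exact: resolution_compact.
move=> X X0; apply: contractible_zero; apply: Cex => k L q phi.
apply: (@resolution_detect R C 'rV[R]_k L q (G (existT _ k L, q)) X) => F.
have := X0 (existT _ k L, q) (\pi_(homotopy_class _ _) F).
by rewrite -(raddf0 (\pi_(homotopy_class _ X))) => /homotopyP; rewrite subr0.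
Qed.
End DirectSumComplex.

(** * Injective modules over a left noetherian ring *)

Section InjectiveClass.
Variable R : pzRingType.
Hypothesis R_noetherian : left_noetherian R.

Lemma infinite_seq (I : choiceType) (A : set I) : infinite_set A ->
  exists f : nat -> I, injective f /\ forall k, A (f k).
Proof.
move=> /infiniteP/card_leP[f].
exists (fun k => val (f (to_setT k))); split=> [k l /val_inj|k].
  by move=> /inj; rewrite !inE => /(_ Logic.I Logic.I) /(congr1 val).
exact: set_mem (valP (f (to_setT k))).
Qed.

(** Otherwise there are distinct indices f 0, f 1, ... each in the support of a
    value of the partial map G.  The ideals L_n of the scalars whose value
    vanishes at f k for all k >= n increase; they exhaust the domain because
    values have finite support.  They are stationary from some N on, so every
    value vanishes at f N, a contradiction. *)
Lemma noetherian_finite_support (I : choiceType) (M : I -> lmodType R)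
    (G : submodule (R^o * dsum M)%type) : functional G ->
  finite_set [set i | exists r z, G (r, z) /\ coord i z <> 0].
Proof.
move=> Gf; apply: contrapT => /infinite_seq[f [finj fP]].
pose L n : set R := [set r | exists z, G (r, z) /\ forall k, (n <= k)%N -> coord (f k) z = 0].
have [n|n r [z [Gz z0]]|N Nstable] := R_noetherian (I := L).
- split.
  + by exists 0; split=> [|k _]; rewrite ?linear0//; exact: carrier0.
  + move=> r r' [z [Gz z0]] [z' [Gz' z0']]; exists (z + z'); split.
      by have := carrierP 1 Gz Gz'; rewrite scale1r.
    by move=> k nk; rewrite linearD /= z0// z0'// addr0.
  + move=> a r [z [Gz z0]]; exists (a *: z); split.
      by have := carrierP a Gz (carrier0 G); rewrite addr0.
    by move=> k nk; rewrite linearZ /= z0// scaler0.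
- by exists z; split=> // k nk; apply: z0; exact: ltnW.
have [r [z [Gz zN]]] := fP N.
have [n nP] : exists n, forall k, (n <= k)%N -> coord (f k) z = 0.
  have /finite_seqP[s sE] : finite_set [set k | coord (f k) z <> 0].
    apply: (@finite_preimage _ _ [set i | coord i z <> 0] f) (coord_fin z).
    by move=> k k' _ _; exact: finj.
  exists (\max_(k <- s) k).+1 => k; apply: contraPP => zk; apply/negP; rewrite -leqNgt.
  have ks : k \in s by have : [set` s] k by rewrite -sE.
  by rewrite (leq_bigmax_seq _ ks).
have : L (maxn n N) r.
  by exists z; split=> // k; rewrite geq_max => /andP[nk _]; exact: nP.
rewrite (Nstable _ (leq_maxr _ _)) => -[z' [Gz' z'N]].
by apply: zN; rewrite (functionalP Gf Gz Gz'); exact: z'N.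
Qed.

(** Baer: a partial map from R takes its values in finitely many summands, so
    it suffices to extend finitely many coordinates. *)
Lemma dsum_injective (I : choiceType) (M : I -> lmodType R) :
  (forall i, injective_module (M i)) -> injective_module (dsum M).
Proof.
move=> Minj; apply: baer => G Gf.
have /finite_seqP[s sE] := noetherian_finite_support Gf.
have sP r z i : G (r, z) -> coord i z <> 0 -> i \in undup s.
  move=> Gz zi; rewrite mem_undup; have : [set` s] i by rewrite -sE; exists r, z.
  by [].
have /dep_choice[w wP] : forall i, exists w : M i, forall r z, G (r, z) ->
    coord i z = (r : R) *: w.
  move=> i; pose H (p : R^o * M i) := exists2 z, G (p.1, z) & p.2 = coord i z.
  have H0 : H 0 by exists 0; [exact: carrier0 | rewrite linear0].
  have HP a p q : H p -> H q -> H (a *: p + q).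
    move=> [z Gz pz] [z' Gz' qz]; exists (a *: z + z'); last by rewrite linearP /= pz qz.
    exact: (@carrierP _ _ G a (_, _) (_, _) Gz Gz').
  have [|g gP] := extend_functional (G := Submodule H0 HP) (Minj i).
    by move=> y [z /= Gz ->]; rewrite (Gf _ Gz) linear0.
  exists (g 1) => r z Gz; rewrite -linearZ /= [_ *: _]mulr1; apply/esym/gP.
  by exists z.
exists (\sum_(i <- undup s) dinj M i (w i)) => r z Gz.
rewrite [LHS](dsum_expand (undup_uniq s) (fun i => @sP r z i Gz)).
by rewrite scaler_sumr; apply: eq_bigr => i _; rewrite (wP i _ _ Gz) linearZ.
Qed.

(** For J injective, a map g : N -> J followed by the embedding of J in the
    power of E indexed by the maps f : J -> E has the components f g, which are
    coordinates of the preenvelope. *)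
Lemma injective_preenvelopes : has_preenvelopes (@injective_module R).
Proof.
move=> N L; pose E : lmodType R := char_mod R.
have [e eP] := product_lift (fun f : hom N E =>
  if `[< kills L f >] then f : {linear N -> E} else \0).
exists (product (fun _ : hom N E => E)), e; split.
- by apply: product_injective => _; exact: char_mod_injective.
- move=> x Lx; apply: functional_extensionality_dep => f; rewrite eP.
  by case: asboolP => // fL; rewrite fL.
move=> J g Jinj gL; have [i [r [iP ir]]] := injective_retract Jinj.
have [t tP] := product_lift (fun f : hom J E =>
  proj ((f \o g : {linear _ -> _}) : hom N E) : {linear product (fun _ : hom N E => E) -> E}).
exists (r \o t : {linear _ -> _}) => x /=.
rewrite -[LHS]ir; congr (r _); apply: functional_extensionality_dep => f.
rewrite iP tP /= /proj eP; case: asboolP => // -[] y Ly /=.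
by rewrite gL ?linear0.
Qed.

End InjectiveClass.

(** * The class Inj(M_1, ..., M_n) *)

Section BihomClass.
Variable R : pzRingType.

Section Bihom.
Variable M : bimodule R.
Implicit Types I J N : lmodType R.

Definition bihom_map I J (u : {linear I -> J}) (f : bihom M I) : bihom M J :=
  (u \o (f : {linear M -> I}) : {linear M -> J}).
Lemma bihom_map_linear I J (u : {linear I -> J}) : linear (bihom_map u).
Proof. by move=> a f g; apply: homP => m; rewrite /= linearD. Qed.
HB.instance Definition _ I J (u : {linear I -> J}) :=
  GRing.isLinear.Build R (bihom M I) (bihom M J) *:%R (bihom_map u) (bihom_map_linear u).

(** Currying; the last condition expresses linearity for the action of R on
    Hom(M, J). *)
Lemma bihom_lift N J (b : N -> M -> J) :
  (forall n, linear (b n)) ->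
  (forall n n' m, b (n + n') m = b n m + b n' m) ->
  (forall r n m, b (r *: n) m = b n (ract m r)) ->
  exists g : {linear N -> (bihom M J : lmodType R)}, forall n m, (g n : {linear M -> J}) m = b n m.
Proof.
move=> bl bD bZ; pose g n : bihom M J := lin (bl n).
have lg : linear g by move=> a n n'; apply: homP => m; rewrite /= bD bZ.
by exists (lin lg).
Qed.

Lemma bihomZ N J (g : {linear N -> (bihom M J : lmodType R)}) r n m :
  (g (r *: n) : {linear M -> J}) m = (g n : {linear M -> J}) (ract m r).
Proof. by rewrite linearZ. Qed.
End Bihom.

Variables (n : nat) (M : 'I_n -> bimodule R).

Lemma Inj_ofP (J : lmodType R) : Inj_of M J <->
  exists I : 'I_n -> lmodType R, (forall j, injective_module (I j)) /\
    retract J (product (fun j => bihom (M j) (I j) : lmodType R)).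
Proof.
by split=> -[I [Iinj JI]]; exists I; split=> //;
  [exact: summand_retract | exact: retract_summand].
Qed.

(** As for injective modules, in each factor Hom(M_j, -): for J a retract of
    the product of the Hom(M_j, I_j), a map g : N -> J has components N ->
    Hom(M_j, I_j), and composing them with the maps f : I_j -> E gives
    coordinates of the preenvelope. *)
Lemma Inj_of_preenvelopes : has_preenvelopes (Inj_of M).
Proof.
move=> N L; pose E : lmodType R := char_mod R.
pose B j : lmodType R := bihom (M j) E.
pose T j := hom N (B j).
pose kill j (f : T j) : {linear N -> B j} :=
  if `[< kills L (f : {linear _ -> _}) >] then f : {linear N -> B j} else \0.
have killL j (f : T j) x : L x -> kill j f x = 0.
  by rewrite /kill; case: asboolP => // fL Lx; exact: fL.
pose P j : lmodType R := product (fun _ : T j => E).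
have /dep_choice[e eP] : forall j, exists e : {linear N -> (bihom (M j) (P j) : lmodType R)},
    forall x m, (e x : {linear _ -> _}) m = (fun f => (kill j f x : {linear _ -> _}) m).
  move=> j; apply: bihom_lift.
  - move=> x a m m'; apply: functional_extensionality_dep => f; exact: linearP.
  - move=> x y m; apply: functional_extensionality_dep => f.
    by rewrite linearD.
  - by move=> r x m; apply: functional_extensionality_dep => f; exact: bihomZ.
have [d dP] := product_lift e.
exists (product (fun j => bihom (M j) (P j) : lmodType R)), d; split.
- apply/Inj_ofP; exists P; split; last by exists idfun, idfun.
  by move=> j; apply: product_injective => _; exact: char_mod_injective.
- move=> x Lx; apply: functional_extensionality_dep => j; rewrite dP.
  apply: homP => m; rewrite eP; apply: functional_extensionality_dep => f.
  by rewrite killL.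
move=> J g /Inj_ofP[I [Iinj [i [r ir]]]] gL.
pose gj j : {linear N -> (bihom (M j) (I j) : lmodType R)} := proj j \o (i \o g).
have /dep_choice[t tP] : forall j, exists t : {linear P j -> I j},
   forall x m, t ((e j x : {linear _ -> _}) m) = (gj j x : {linear _ -> _}) m.
  move=> j; have [ij [rj [ijP irj]]] := injective_retract (Iinj j).
  have [s sP] := product_lift (fun phi : hom (I j) E =>
    proj ((bihom_map phi \o gj j : {linear N -> B j}) : T j) : {linear P j -> E}).
  exists (rj \o s : {linear _ -> _}) => x m /=.
  rewrite -[RHS]irj; congr (rj _); apply: functional_extensionality_dep => f.
  rewrite ijP sP /= /proj eP /kill; case: asboolP => // -[] y Ly /=.
  by rewrite gL// !linear0.
have [h hP] := product_lift (fun j => bihom_map (t j) \o proj j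
   : {linear product (fun j => bihom (M j) (P j) : lmodType R) -> (bihom (M j) (I j) : lmodType R)}).
exists (r \o h : {linear _ -> _}) => x /=.
rewrite -[LHS]ir; congr (r _); apply: functional_extensionality_dep => j.
by rewrite hP /= /proj dP; apply: homP => m; rewrite /= tP.
Qed.

Hypothesis R_noetherian : left_noetherian R.
Hypothesis M_fg : forall j, finitely_generated (left_mod (M j)).

(** Hom(M_j, -) commutes with direct sums because M_j is finitely generated. *)
Lemma Inj_of_dsum (S : choiceType) (J : S -> lmodType R) :
  (forall s, Inj_of M (J s)) -> Inj_of M (dsum J).
Proof.
move=> JM.
have /dep_choice[I IP] : forall s, exists I : 'I_n -> lmodType R,
    (forall j, injective_module (I j)) /\
    retract (J s) (product (fun j => bihom (M j) (I j) : lmodType R)).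
  by move=> s; exact/Inj_ofP.
have /dep_choice[i iP] := fun s => (IP s).2; have /dep_choice[r ir] := iP.
apply/Inj_ofP; exists (fun j => dsum (fun s => I s j)); split.
  by move=> j; apply: dsum_injective => // s; exact: (IP s).1.
pose D j := dsum (fun s => I s j).
have /dep_choice[u uP] : forall j, exists u : {linear dsum J -> (bihom (M j) (D j) : lmodType R)},
    forall x m s, coord s ((u x : {linear _ -> _}) m) = (i s (coord s x) j : {linear _ -> _}) m.
  move=> j.
  have /dep_choice[b bP] : forall x : dsum J, exists b : {linear M j -> D j}, forall m s,
      coord s (b m) = (i s (coord s x) j : {linear _ -> _}) m.
    move=> x; apply: dsum_lift => m; apply: sub_finite_set (coord_fin x) => s /=.
    by apply: contra_not => ->; rewrite linear0.
  have [| | |u uP] := @bihom_lift (M j) (dsum J) (D j) b.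
  - by move=> x; exact: linearP.
  - by move=> x y m; apply: coord_inj => s; rewrite linearD /= !bP !linearD.
  - move=> a x m; apply: coord_inj => s; rewrite !bP.
    have -> : coord s (a *: x) = a *: coord s x by [].
    by rewrite linearZ.
  by exists u => x m s; rewrite uP bP.
have [d dP] := product_lift u.
pose P := product (fun j => bihom (M j) (D j) : lmodType R).
have /dep_choice[k kP] : forall s, exists k : {linear P -> product (fun j => bihom (M j) (I s j) : lmodType R)},
    forall y j, k y j = bihom_map (coord s) (y j).
  move=> s; have [k kP] := product_lift (fun j => bihom_map (coord s) \o proj j
    : {linear P -> (bihom (M j) (I s j) : lmodType R)}).
  by exists k => y j; rewrite kP.
have [y|rho rhoP] := dsum_lift (f := fun s => (r s \o k s : {linear P -> J s})).
  have /dep_choice[t tP] : forall j, exists t : seq S, forall m s,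
      coord s ((y j : {linear _ -> _}) m) <> 0 -> s \in t.
    by move=> j; have [t _ tP] := fg_support (y j : {linear M j -> D j}) (M_fg j); exists t.
  apply: sub_finite_set (finite_seq (flatten [seq t j | j <- enum 'I_n])) => s /=.
  apply: contra_notT => st; suff -> : k s y = 0 by rewrite linear0.
  apply: functional_extensionality_dep => j; rewrite kP; apply: homP => m /=.
  apply: contrapT => /tP sj; move/negP: st; apply.
  by apply/flattenP; exists (t j) => //; apply: map_f; rewrite mem_enum.
exists d, rho => x; apply: coord_inj => s; rewrite rhoP /= -[RHS](ir s); congr (r s _).
apply: functional_extensionality_dep => j; rewrite kP dP.
by apply: homP => m; rewrite /= uP.
Qed.

End BihomClass.

Section InjectiveTerms.
Variables (R : pzRingType) (C : lmodType R -> Prop).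
Hypothesis C_inj : forall J, C J -> injective_module J.

(** A partial g with d g = f is extended to x as follows.  By injectivity some
    w0 agrees with g on the multiples of x where g is defined.  The error y = d
    w0 - f x is a cycle annihilated by the ideal of these scalars, hence r |->
    r y is d g2 for some g2 : R -> X vanishing on this ideal.  Then w0 - g2 1
    is the value at x. *)
Lemma injective_hom_exact (X : complex C) : hom_fg_exact X -> forall N, hom_exact N X.
Proof.
move=> Xfg N i f; split=> [df|[g gP] x]; last by rewrite -gP complex_diff.
pose P (p : N * X (i + 1 + 1)) := diff X (i + 1) p.2 = f p.1.
have P0 : P 0 by rewrite /P !linear0.
have PP a p q : P p -> P q -> P (a *: p + q) by rewrite /P !linearP => -> ->.
have [||G _ GP Gf x|g [gP _]] :=
  @zorn_extension R N _ (Submodule P0 PP) (zero_submodule _).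
- by move=> _ ->.
- by move=> z [].
- pose c (p : R^o * X (i + 1 + 1)) := G ((p.1 : R) *: x, p.2).
  have c0 : c 0 by rewrite /c /= scale0r; exact: carrier0.
  have cP a p q : c p -> c q -> c (a *: p + q).
    move=> cp cq; rewrite /c [X in G (X, _)](_ : _ = a *: ((p.1 : R) *: x) + (q.1 : R) *: x);
      [exact: (@carrierP _ _ G a (_, _) (_, _) cp cq) | by rewrite scalerA -scalerDl].
  have cf : functional (Submodule c0 cP) by move=> z; rewrite /= /c /= scale0r; exact: Gf.
  have [g1 g1P] := extend_functional (C_inj (complex_class X (i + 1 + 1))) cf.
  have g1E r : g1 r = (r : R) *: g1 1 by rewrite -linearZ /= [_ *: _]mulr1.
  pose y := diff X (i + 1) (g1 1) - f x.
  pose L : set 'rV[R]_1 := [set v | exists z, G (v 0 0 *: x, z)].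
  have lphi : linear (fun v : 'rV[R]_1 => v 0 0 *: y).
    by move=> a u v; rewrite !mxE scalerDl scalerA.
  have [||g [gL gP]] := Xfg 1%N L i (lin lphi).
  + move=> v [z Gz] /=; have zE : z = v 0 0 *: g1 1 by rewrite -g1E; apply/esym/g1P.
    have := GP _ Gz; rewrite /= /P /= zE !linearZ /= => dz.
    by rewrite /y scalerBr dz subrr.
  + by move=> v; rewrite /= linearZ /= /y linearB /= complex_diff df subrr scaler0.
  exists (g1 1 - g (const_mx 1)); split.
    have := gP (const_mx 1); rewrite /= mxE scale1r /P /= linearB /= => <-.
    by rewrite /y opprB addrCA subrr addr0.
  move=> r z Gz; have gr : g (r *: const_mx 1) = 0.
    by apply: gL; exists z; rewrite !mxE mulr1.
  by rewrite scalerBr -g1E -linearZ gr subr0; apply/esym/g1P.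
by exists g.
Qed.
End InjectiveTerms.

(** * Tensor products and flatness *)

Lemma quot_factor (R : pzRingType) (V : lmodType R) (S : submodule V) (U : zmodType)
    (g : {additive V -> U}) : (forall x, S x -> g x = 0) ->
  exists h : {additive quot_mod S -> U}, forall x, h (quot_pi S x) = g x.
Proof.
move=> gS.
have gq x y : quot_pi S x = quot_pi S y -> g x = g y.
  by move=> /quot_piP/gS; rewrite raddfB => /eqP; rewrite subr_eq0 => /eqP.
have /choice[h hP] : forall q : quot_mod S, exists u, forall x, quot_pi S x = q -> g x = u.
  by move=> q; have [x <-] := quot_pi_surj q; exists (g x) => y /gq.
have hadd : zmod_morphism h.
  move=> p q; have [x xp] := quot_pi_surj p; have [y yq] := quot_pi_surj q.
  by rewrite -(hP _ _ xp) -(hP _ _ yq) -raddfB; apply/esym/hP; rewrite linearB /= xp yq.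
pose h' : {additive quot_mod S -> U} := HB.pack h (GRing.isZmodMorphism.Build _ _ h hadd).
by exists h' => x; exact/esym/hP.
Qed.

Section Tensor.
Variables (R : pzRingType) (M : bimodule R).
Implicit Types A B : lmodType R.

Definition formal B : lmodType R := dsum (fun _ : B => left_mod M).
Definition pure_tensor B (b : B) (m : M) : formal B := dinj (fun _ : B => left_mod M) b m.

(** The relations defining M (x) B in the direct sum of copies of M indexed by
    B; additivity in M is built in the direct sum. *)
Inductive relator B : formal B -> Prop :=
| relator0 : relator 0
| relatorB u v of relator u & relator v : relator (u - v)
| relatorD m (b b' : B) :
    relator (pure_tensor b m + pure_tensor b' m - pure_tensor (b + b') m)
| relatorZ m r (b : B) :
    relator (pure_tensor b (ract m r) - pure_tensor (r *: b) m).

Lemma pure_tensorD B (b : B) m m' :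
  pure_tensor b (m + m') = pure_tensor b m + pure_tensor b m'.
Proof. exact: linearD. Qed.
Lemma pure_tensorZ B (b : B) a m : pure_tensor b (a *: m) = a *: pure_tensor b m.
Proof. exact: linearZ. Qed.

Lemma relator_scale B a (u : formal B) : relator u -> relator (a *: u).
Proof.
elim=> [|{}u v _ IHu _ IHv|m b b'|m r b].
- rewrite scaler0; exact: relator0.
- by rewrite scalerBr; exact: relatorB.
- rewrite scalerBr scalerDr -!pure_tensorZ; exact: relatorD.
- rewrite scalerBr -!pure_tensorZ -ractZ; exact: relatorZ.
Qed.

Lemma relatorP B a (u v : formal B) : relator u -> relator v -> relator (a *: u + v).
Proof.
move=> Ku Kv; rewrite -[v]opprK -[- v]sub0r.
apply: relatorB; first exact: relator_scale.
by apply: relatorB Kv; exact: relator0.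
Qed.

Definition relators B : submodule (formal B) := Submodule (@relator0 B) (@relatorP B).

Definition tensor B : lmodType R := quot_mod (relators B).
Definition tens B (m : right_mod M) (b : B) : tensor B :=
  quot_pi (relators B) (pure_tensor b m).

Lemma tens_balanced B : balanced (@tens B : right_mod M -> B -> (tensor B : zmodType)).
Proof.
split=> [m m' b|m b b'|m r b]; rewrite /tens.
- by rewrite pure_tensorD linearD.
- apply/esym; rewrite -linearD; apply/quot_piP; exact: relatorD.
- by apply/quot_piP; exact: relatorZ.
Qed.

(** A balanced map b sends a formal sum u to the sum over a of b (u_a) a, which
    is additive in u and vanishes on the relators. *)
Lemma tens_is_tensor B : is_tensor (@tens B : right_mod M -> B -> (tensor B : zmodType)).
Proof.
split=> [|U b [bD bD' bZ]]; first exact: tens_balanced.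
split.
  have b0 a : b 0 a = 0 by apply: (addrI (b 0 a)); rewrite -bD !addr0.
  pose g (u : formal B) := \sum_(a \in [set: B]) b (coord a u : M) a.
  have gseq (u : formal B) r : uniq r -> (forall i, coord i u <> 0 -> i \in r) ->
      g u = \sum_(a <- r) b (coord a u : M) a.
    move=> ur ru; apply: fsum_seq => // i bi; apply: ru; apply: contra_not bi => ->.
    exact: b0.
  have gB : zmod_morphism g.
    move=> u v; have [r [ur xr yr]] := dsum_supp_seq u v.
    rewrite (gseq u r)// (gseq v r)// (gseq (u - v) r)//; last first.
      move=> i; rewrite linearB /=; apply: contra_notT => ir.
      have -> : coord i u = 0 by apply: contrapT => /xr; apply/negP.
      have -> : coord i v = 0 by apply: contrapT => /yr; apply/negP.
      by rewrite subr0.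
    rewrite -sumrB; apply: eq_bigr => a _; apply: (addIr (b (coord a v : M) a)).
    by rewrite subrK -bD linearB /= subrK.
  pose g' : {additive formal B -> U} := HB.pack g (GRing.isZmodMorphism.Build _ _ g gB).
  have g'E m a : g' (pure_tensor a m) = b m a.
    rewrite /= (gseq _ [:: a])// ?big_seq1 /pure_tensor ?coord_dinj// => j.
    by apply: contra_notT; rewrite inE => ja; rewrite coord_dinj_neq.
  have [|h hP] := @quot_factor R (formal B) (relators B) U g'.
    move=> u /=; elim=> [|{}u v _ IHu _ IHv|m a a'|m r a].
    - exact: (raddf0 g').
    - by rewrite [LHS](raddfB g') /= IHu IHv subr0.
    - by rewrite [LHS](raddfB g') (raddfD g') !g'E bD' subrr.
    - by rewrite [LHS](raddfB g') !g'E -bZ subrr.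
  by exists h => m a; rewrite /tens hP.
move=> h h' hb hb' q; have [u <-] := quot_pi_surj q.
apply: (dsum_hom_ext (f := h \o quot_pi (relators B)) (g := h' \o quot_pi (relators B))).
by move=> a m; rewrite /= hb hb'.
Qed.

(** A map f : A -> Hom(M, I) is an R-linear map M (x) A -> I.  The hypothesis
    says that it factors through the image of M (x) A in M (x) B, from which it
    extends to M (x) B as I is injective. *)
Lemma bihom_extend (I : lmodType R) A B (i : {linear A -> B})
    (f : {linear A -> (bihom M I : lmodType R)}) : injective_module I ->
  (forall s : seq (M * A), relator (\sum_(p <- s) pure_tensor (i p.2) p.1) ->
     \sum_(p <- s) (f p.2 : {linear _ -> _}) p.1 = 0) ->
  exists g : {linear B -> (bihom M I : lmodType R)}, forall a, g (i a) = f a.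
Proof.
move=> Iinj fK.
pose sumB (s : seq (M * A)) := \sum_(p <- s) pure_tensor (i p.2) p.1.
pose sumI (s : seq (M * A)) := \sum_(p <- s) (f p.2 : {linear _ -> _}) p.1.
pose G (p : formal B * I) := exists2 s, relator (p.1 - sumB s) & p.2 = sumI s.
have G0 : G 0.
  exists [::]; rewrite /sumB /sumI big_nil// subr0; exact: relator0.
have GP a p q : G p -> G q -> G (a *: p + q).
  move=> [s Ks ps] [t Kt qt].
  exists ([seq (a *: x.1, x.2) | x <- s] ++ t); last first.
    rewrite /= ps qt /sumI big_cat big_map scaler_sumr; congr (_ + _).
    by apply: eq_bigr => x _; rewrite linearZ.
  have -> : (a *: p + q).1 - sumB ([seq (a *: x.1, x.2) | x <- s] ++ t) =
      a *: (p.1 - sumB s) + (q.1 - sumB t).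
    rewrite /sumB big_cat big_map /= scalerBr opprD addrACA; congr (_ + _).
    congr (_ - _); rewrite scaler_sumr; apply: eq_bigr => x _; exact: pure_tensorZ.
  exact: relatorP.
have [z [s Ks /= ->]|g gP] := extend_functional (G := Submodule G0 GP) Iinj.
  apply: fK; move: Ks; rewrite sub0r => /(relator_scale (-1)).
  by rewrite scaleN1r opprK.
have gK u : relator u -> g u = 0.
  by move=> Ku; apply: gP; exists [::]; rewrite /sumB /sumI big_nil// subr0.
have [|b b' m|r b m|h hP] := @bihom_lift R M B I (fun b m => g (pure_tensor b m)).
- by move=> b a m m'; rewrite pure_tensorD pure_tensorZ linearP.
- apply/eqP; rewrite eq_sym -subr_eq0 -linearD -linearB; apply/eqP/gK; exact: relatorD.
- apply/eqP; rewrite eq_sym -subr_eq0 -linearB; apply/eqP/gK; exact: relatorZ.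
exists h => a; apply: homP => m; rewrite hP; apply: gP.
exists [:: (m, a)]; rewrite /sumB /sumI big_seq1//= subrr; exact: relator0.
Qed.

(** By flatness M (x) A -> M (x) B is injective, so a formal sum that vanishes
    in M (x) B already vanishes in M (x) A. *)
Lemma flat_bihom_injective (I : lmodType R) :
  flat (right_mod M) -> injective_module I -> injective_module (bihom M I).
Proof.
move=> Mflat Iinj A B i f iinj; apply: bihom_extend => // s Ks.
have iB : balanced (fun (m : right_mod M) a => tens m (i a) : (tensor B : zmodType)).
  have [tD tD' tZ] := tens_balanced B.
  by split=> [m m' a|m a a'|m r a]; rewrite ?linearD ?linearZ /= ?tD ?tD' ?tZ.
have [[h hP] _] := (tens_is_tensor A).2 _ _ iB.
have hinj := Mflat _ _ i iinj _ _ _ _ (tens_is_tensor A) (tens_is_tensor B) h hP.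
pose u : formal A := \sum_(p <- s) pure_tensor p.2 p.1.
have Ku : relator u.
  apply/(quot_pi_eq0 (relators A)); apply: hinj; rewrite raddf0.
  rewrite linear_sum raddf_sum /=.
  rewrite (eq_bigr (fun p => quot_pi (relators B) (pure_tensor (i p.2) p.1))).
    by rewrite -linear_sum; apply/quot_pi_eq0.
  by move=> p _; exact: hP.
have : copair (fun a => f a : {linear M -> I}) u = 0.
  move: u Ku => u; elim=> [|{}u v _ IHu _ IHv|m a a'|m r a].
  - exact: linear0.
  - by rewrite linearB /= IHu IHv subrr.
  - by rewrite !linearB !linearD /= !copair_dinj linearD subrr.
  - by rewrite linearB /= !copair_dinj linearZ subrr.
rewrite linear_sum /= => H; rewrite -[RHS]H; apply: eq_bigr => p _.
by rewrite /pure_tensor copair_dinj.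
Qed.
End Tensor.

Lemma Inj_of_injective (R : pzRingType) (n : nat) (M : 'I_n -> bimodule R) (J : lmodType R) :
  (forall j, flat (right_mod (M j))) -> Inj_of M J -> injective_module J.
Proof.
move=> Mflat /Inj_ofP[I [Iinj JI]]; apply: retract_injective JI _.
by apply: product_injective => j; exact: flat_bihom_injective.
Qed.

(** * Pure exactness and pure injectivity *)

Section LinearCombinations.
Variable R : pzRingType.
Implicit Types U V : lmodType R.

Definition row_comb V k (t : 'I_k -> V) (v : 'rV[R]_k) : V := \sum_j v 0 j *: t j.
Lemma row_comb_linear V k (t : 'I_k -> V) : linear (row_comb t).
Proof.
move=> a u v; rewrite /row_comb scaler_sumr -big_split; apply: eq_bigr => j _.
by rewrite !mxE scalerDl scalerA.
Qed.
HB.instance Definition _ V k (t : 'I_k -> V) :=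
  GRing.isLinear.Build R 'rV[R]_k V *:%R (row_comb t) (row_comb_linear t).

Lemma row_comb_delta V k (t : 'I_k -> V) (v : 'rV[R]_k) j :
  (forall l, v 0 l = (l == j)%:R) -> row_comb t v = t j.
Proof.
move=> vE; rewrite /row_comb (bigD1 j)//= vE eqxx scale1r big1 ?addr0// => l lj.
by rewrite vE (negbTE lj) scale0r.
Qed.

Lemma row_free_presented k : finitely_presented ('rV[R]_k : lmodType R).
Proof.
exists k, 0%N, idfun, \0; split=> [x|x]; first by exists x.
by split=> [/= ->|[y <-]//]; exists 0.
Qed.

Lemma quotient_presented k (ts : seq 'rV[R]_k) :
  exists (N : lmodType R) (p : {linear 'rV[R]_k -> N}), [/\ finitely_presented N,
    forall y, exists x, p x = y, forall t, t \in ts -> p t = 0 &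
    forall U (f : {linear 'rV[R]_k -> U}), (forall t, t \in ts -> f t = 0) ->
      forall x, p x = 0 -> f x = 0].
Proof.
pose q := row_comb (fun j : 'I_(size ts) => ts`_j).
exists (quot_mod (range_submodule q)), (quot_pi (range_submodule q)); split.
- exists k, (size ts), (quot_pi (range_submodule q)), q.
  by split=> [y|x]; [exact: quot_pi_surj | exact: quot_pi_eq0].
- exact: quot_pi_surj.
- move=> t /(nthP 0)[j js <-]; apply/quot_pi_eq0.
  exists (\row_l (l == Ordinal js)%:R) => /=.
  by rewrite /q (@row_comb_delta _ _ _ _ (Ordinal js))// => l; rewrite mxE.
- move=> U f ft x /quot_pi_eq0[y <-]; rewrite /q /row_comb linear_sum big1// => j _.
  by rewrite linearZ /= ft ?scaler0// mem_nth.
Qed.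

Definition lincomb (B : Type) V (y : B -> V) (c : seq (R * B)) : V :=
  \sum_(p <- c) p.1 *: y p.2.

Lemma lincomb_comp (B : Type) U V (y : B -> U) (f : {linear U -> V}) c :
  lincomb (fun b => f (y b)) c = f (lincomb y c).
Proof. by rewrite /lincomb linear_sum; apply: eq_bigr => p _; rewrite linearZ. Qed.
End LinearCombinations.

Section PureExact.
Variables (R : pzRingType) (Y : sequence R).
Hypothesis Y_pure : pure_exact Y.

(** Exactness on elements is exactness on maps from R. *)
Lemma pure_exact_elt (i : int) (x : Y (i + 1)) :
  diff Y i x = 0 <-> exists z, diff Y (i + 1) z = x.
Proof.
have one (V : lmodType R) (v : V) : row_comb (fun _ : 'I_1 => v) (const_mx 1) = v.
  by rewrite /= /row_comb big_ord1 mxE scale1r.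
have [H1 H2] := @Y_pure _ (row_free_presented R 1) i (row_comb (fun _ : 'I_1 => x)).
split=> [dx|[z zx]].
  have [v|g gP] := H1; first by rewrite /= /row_comb big_ord1 linearZ /= dx scaler0.
  by exists (g (const_mx 1)); exact: etrans (gP _) (one _ _).
rewrite -[x]one; apply: H2; exists (row_comb (fun _ : 'I_1 => z)) => v.
by rewrite /= /row_comb !big_ord1 linearZ /= zx.
Qed.

(** Let p : R^k -> N be the quotient by ts.  Then d sigma factors through p,
    and as N is finitely presented this factorization lifts to g : N -> Y with
    d g p = d sigma; sigma - g p is a cycle, hence is d x for some x : R^k ->
    Y, and g p vanishes on ts. *)
Lemma pure_exact_lift (j : int) k (sigma : {linear 'rV[R]_k -> Y (j + 1 + 1)}) (ts : seq 'rV[R]_k) :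
  (forall t, t \in ts -> exists a, sigma t = diff Y (j + 1 + 1) a) ->
  exists x : {linear 'rV[R]_k -> Y (j + 1 + 1 + 1)},
    forall t, t \in ts -> diff Y (j + 1 + 1) (x t) = sigma t.
Proof.
move=> tsP.
have dd (l : int) x : diff Y l (diff Y (l + 1) x) = 0.
  by apply/pure_exact_elt; exists x.
have [N [p [Nfp psurj pts pker]]] := quotient_presented ts.
have [|f fP] := factor_surj (g := diff Y (j + 1) \o sigma) psurj.
  by apply: pker => t /tsP[a] /= ->; exact: dd.
have [y|g gP] := (@Y_pure _ Nfp j f).1.
  by have [x <-] := psurj y; rewrite fP /= dd.
pose u : hom 'rV[R]_k (Y (j + 1 + 1)) := (sigma : hom _ _) - ((g \o p : {linear _ -> _}) : hom _ _).
have [v|x xP] := (@Y_pure _ (row_free_presented R k) (j + 1) u).1.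
  by rewrite /u linearB /= gP fP subrr.
by exists x => t tt; rewrite xP /u /= (pts _ tt) linear0 subr0.
Qed.

(** Finitely many elements b of Y_i occur in cs and s.  Mapping the basis of a
    free module to them turns the linear relations cs and the equations b = d a
    into vectors whose images are boundaries. *)
Lemma local_section (i : int) (cs : seq (seq (R * Y i))) (s : seq (Y (i + 1))) :
  (forall c, c \in cs -> lincomb idfun c = 0) ->
  exists y : Y i -> Y (i + 1),
    (forall c, c \in cs -> diff Y i (lincomb y c) = 0) /\
    (forall a, a \in s -> diff Y i (y (diff Y i a)) = diff Y i a).
Proof.
have [j ij] : exists j, i = j + 1 + 1 by exists (i - 1 - 1); rewrite !subrK.
subst i => cs0.
pose S := undup ([seq p.2 | p <- flatten cs] ++ [seq diff Y (j + 1 + 1) a | a <- s]).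
pose sigma : {linear 'rV[R]_(size S) -> Y (j + 1 + 1)} := row_comb (fun l : 'I_(size S) => S`_l).
pose del b : 'rV[R]_(size S) := \row_l (S`_l == b)%:R.
have sdel b : b \in S -> sigma (del b) = b.
  move=> bS; have bs : (index b S < size S)%N by rewrite index_mem.
  rewrite /sigma /= (@row_comb_delta _ _ _ _ _ (Ordinal bs)) ?nth_index// => l.
  by rewrite mxE -{1}(nth_index 0 bS) nth_uniq ?undup_uniq// index_mem.
have scs c : c \in cs -> sigma (lincomb del c) = 0.
  move=> cc; rewrite -lincomb_comp -[RHS](cs0 _ cc) /lincomb big_seq [RHS]big_seq.
  apply: eq_bigr => p pc; rewrite sdel// mem_undup mem_cat; apply/orP; left.
  by apply: map_f; apply/flattenP; exists c.
have [t|x xP] := @pure_exact_lift j _ sigma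
    ([seq lincomb del c | c <- cs] ++ [seq del (diff Y (j + 1 + 1) a) | a <- s]).
  rewrite mem_cat => /orP[] /mapP[c cc ->].
    by exists 0; rewrite scs// linear0.
  by exists c; rewrite sdel// mem_undup mem_cat map_f ?orbT.
exists (fun b => x (del b)); split=> [c cc|a aa].
  by rewrite lincomb_comp xP ?scs// mem_cat map_f.
rewrite xP; last by rewrite mem_cat (map_f (fun a => del (diff _ _ a))) ?orbT.
by rewrite sdel// mem_undup mem_cat map_f ?orbT.
Qed.
End PureExact.

(** The vanishing of u in M (x) B uses finitely many linear relations in B: any
    function y on B, even if it is not linear, that satisfies them induces a
    map that vanishes on u. *)
Lemma relator_finite (R : pzRingType) (M : bimodule R) (I B : lmodType R)
    (u : formal M B) : relator u ->
  exists cs : seq (seq (R * B)), (forall c, c \in cs -> lincomb idfun c = 0) /\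
    forall y : B -> (bihom M I : lmodType R), (forall c, c \in cs -> lincomb y c = 0) ->
      copair (fun b => y b : {linear M -> I}) u = 0.
Proof.
have evD (f g : bihom M I) m : ((f + g : bihom M I) : {linear M -> I}) m =
   (f : {linear M -> I}) m + (g : {linear M -> I}) m by [].
elim=> [|{}u v _ [cs [cs0 csP]] _ [ds [ds0 dsP]]|m b b'|m r b].
- by exists [::]; split=> // y _; rewrite linear0.
- exists (cs ++ ds); split=> [c|y yP].
    by rewrite mem_cat => /orP[/cs0|/ds0].
  rewrite linearB /= csP ?dsP ?subrr// => c cc; apply: yP; rewrite mem_cat cc ?orbT//.
- exists [:: [:: (1, b); (1, b'); (-1, b + b')]]; split=> [c|y].
    rewrite inE => /eqP ->; rewrite /lincomb !big_cons big_nil /= !scale1r scaleN1r addr0.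
    by rewrite addrA subrr.
  move=> /(_ _ (mem_head _ _)); rewrite /lincomb !big_cons big_nil /=.
  rewrite !scale1r scaleN1r addr0 addrA => /eqP; rewrite subr_eq0 => /eqP yE.
  by rewrite !linearB !linearD /= !copair_dinj -yE evD subrr.
- exists [:: [:: (r, b); (-1, r *: b)]]; split=> [c|y].
    rewrite inE => /eqP ->; rewrite /lincomb !big_cons big_nil /= scaleN1r addr0.
    by rewrite subrr.
  move=> /(_ _ (mem_head _ _)); rewrite /lincomb !big_cons big_nil /=.
  rewrite scaleN1r addr0 => /eqP; rewrite subr_eq0 => /eqP yE.
  by rewrite linearB /= !copair_dinj -yE subrr.
Qed.

Section PureInjective.
Variable R : pzRingType.

(** Exactness of Hom(Y, J) for pure exact Y, in the direction that extends
    maps. *)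
Definition pure_injective (J : lmodType R) := forall Y : sequence R, pure_exact Y ->
  forall (i : int) (f : {linear Y (i + 1) -> J}), (forall x, f (diff Y (i + 1) x) = 0) ->
  exists g : {linear Y i -> J}, forall x, g (diff Y i x) = f x.

(** If a sum of the m (x) d a vanishes in M (x) Y_i, only finitely many linear
    relations are involved, and there is a partial section y of d respecting
    them modulo the kernel of d.  Since f vanishes on this kernel, f y
    satisfies them, and f y (d a) = f a. *)
Lemma bihom_pure_injective (M : bimodule R) (I : lmodType R) :
  injective_module I -> pure_injective (bihom M I).
Proof.
move=> Iinj Y Ypure i f fd; apply: bihom_extend => // s Ks.
have [cs [cs0 csP]] := relator_finite I Ks.
have [y [ycs ys]] := local_section Ypure (unzip2 s) cs0.
have fdiff a : diff Y i a = 0 -> f a = 0.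
  by move=> /(pure_exact_elt Ypure)[z <-]; exact: fd.
have := csP (fun b => f (y b)).
rewrite linear_sum /= => H; rewrite -[RHS]H; last first.
  by move=> c cc; rewrite lincomb_comp fdiff// ycs.
rewrite big_seq [RHS]big_seq; apply: eq_bigr => p ps.
rewrite /pure_tensor copair_dinj (_ : f (y (diff Y i p.2)) = f p.2)//.
apply/eqP; rewrite -subr_eq0 -linearB; apply/eqP/fdiff.
by rewrite linearB /= ys ?subrr// map_f.
Qed.

Lemma product_pure_injective (S : choiceType) (J : S -> lmodType R) :
  (forall s, pure_injective (J s)) -> pure_injective (product J).
Proof.
move=> JP Y Ypure i f fd.
have /dep_choice[g gP] : forall s, exists g : {linear Y i -> J s},
    forall x, g (diff Y i x) = proj s (f x).
  move=> s; apply: (JP s Y Ypure i (proj s \o f : {linear _ -> _})) => x /=.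
  by rewrite fd linear0.
have [h hP] := product_lift g; exists h => x.
by apply: functional_extensionality_dep => s; rewrite hP gP.
Qed.

Lemma retract_pure_injective (J P : lmodType R) :
  retract J P -> pure_injective P -> pure_injective J.
Proof.
move=> [u [r ur]] Ppi Y Ypure i f fd.
have [x|g gP] := Ppi Y Ypure i (u \o f : {linear _ -> _}).
  by rewrite /= fd linear0.
by exists (r \o g : {linear _ -> _}) => x /=; rewrite gP /= ur.
Qed.

Lemma Inj_of_pure_injective (n : nat) (M : 'I_n -> bimodule R) (J : lmodType R) :
  Inj_of M J -> pure_injective J.
Proof.
move=> /Inj_ofP[I [Iinj JI]]; apply: retract_pure_injective JI _.
by apply: product_pure_injective => j; exact: bihom_pure_injective.
Qed.

Variable C : lmodType R -> Prop.

Lemma hom_fg_exact_pure (X : complex C) : hom_fg_exact X -> pure_exact X.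
Proof.
move=> Xfg N [k [l [p [q [psurj pq]]]]] i f; split=> [df|[g gP] x]; last first.
  by rewrite -gP complex_diff.
have [x /= px|x|g [gL gP]] := Xfg k [set x | p x = 0] i (f \o p : {linear _ -> _}).
- by rewrite px linear0.
- exact: df.
have [h hP] := factor_surj psurj gL; exists h => y.
by have [x <-] := psurj y; rewrite hP -gP.
Qed.

Hypothesis C_pinj : forall J, C J -> pure_injective J.

(** Descending induction on the degree i in the resolution.  Write f = d g by
    pure projectivity.  The restriction of g to Y_(i+1) is a cycle, so by
    induction it is d h, and h extends to k on Y_i as the terms of X are pure
    injective; g - d k is the required map. *)
Lemma pure_resolution_step (X : complex C) (Y : sequence R) (d : nat) :
  pure_exact X -> pure_exact Y ->
  (forall i : int, 0 <= i <= d%:Z -> pure_projective (Y i)) ->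
  (forall i : int, d%:Z < i -> forall x : Y i, x = 0) ->
  forall i : int, 0 <= i -> forall (j : int) (f : {linear Y i -> X (j + 1)}),
  (forall x, f (diff Y i x) = 0) -> (forall x, diff X j (f x) = 0) ->
  exists g : {linear Y i -> X (j + 1 + 1)},
    (forall x, g (diff Y i x) = 0) /\ forall x, diff X (j + 1) (g x) = f x.
Proof.
move=> Xp Yp Yproj Y0 i i0.
have [m im] : exists m : nat, d%:Z + 1 - i <= m%:Z by exists (absz (d%:Z + 1 - i)%R); lia.
elim: m i i0 im => [|m IH] i i0 im j f fd df.
  by exists \0; split=> // x; rewrite linear0 (Y0 i _ x) ?linear0//; lia.
have [di|id] := ltP d%:Z i.
  by exists \0; split=> // x; rewrite linear0 (Y0 i _ x) ?linear0//; lia.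
have ii : 0 <= i <= d%:Z by lia.
have [g gP] := (Yproj i ii X Xp j f).1 df.
have i1 : 0 <= i + 1 by lia.
have im1 : d%:Z + 1 - (i + 1) <= m%:Z by lia.
have [x|x|h [hd hP]] := IH (i + 1) i1 im1 (j + 1) (g \o diff Y i : {linear _ -> _}).
- rewrite /=; have -> : diff Y i (diff Y (i + 1) x) = 0; last exact: linear0.
  by apply/(pure_exact_elt Yp); exists x.
- by rewrite /= gP fd.
have [k kP] := C_pinj (complex_class X (j + 1 + 1 + 1)) Yp hd.
exists ((g : hom _ _) - ((diff X (j + 1 + 1) \o k : {linear _ -> _}) : hom _ _)).
split=> x /=; first by rewrite kP hP /= subrr.
by rewrite linearB /= complex_diff subr0 gP.
Qed.

(** A map f on N is pulled back to the degree 0 term of the resolution and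
    solved there; the solution descends to N because maps from N into modules
    of C are determined by their restrictions along the surjection D, again by
    pure injectivity. *)
Lemma pure_gldim_hom_exact (X : complex C) :
  finite_pure_gldim R -> pure_exact X -> forall N, hom_exact N X.
Proof.
move=> [d res] Xp N; have [Y [Yp [e [e' ee' e'e]] Yproj Y0]] := res N.
(* i = -2, so that N is the term of degree i + 1 *)
have [i [ii E]] : exists i : int, i < -1 /\ -1 = i + 1 by exists (-2).
move: e e' ee' e'e; rewrite E => e e' ee' e'e j f.
split=> [df|[g gP] x]; last by rewrite -gP complex_diff.
pose D := diff Y (i + 1).
(* Exactness of Hom(Y, J) in degree i + 1, where maps extend from Y_(i+1) to Y_i = 0. *)
have DP (J : lmodType R) (h h' : {linear Y (i + 1) -> J}) : C J -> (forall x, h (D x) = h' (D x)) ->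
    forall x, h x = h' x.
  move=> CJ hh'.
  have [x|k kP] := C_pinj CJ Yp (f := ((h : hom _ _) - (h' : hom _ _) : hom _ _)).
    by rewrite /= hh' subrr.
  move=> x; apply/eqP; rewrite -subr_eq0; apply/eqP; rewrite -[LHS]kP.
  by rewrite (Y0 i _ (diff Y i x)) ?linear0// ii.
have i2 : 0 <= i + 1 + 1 by rewrite -E.
have Ygt (l : int) : d%:Z < l -> forall x : Y l, x = 0.
  by move=> dl x; apply: Y0; rewrite dl orbT.
have [x|x|g [gd gP]] := @pure_resolution_step X Y d Xp Yp Yproj Ygt _ i2 j
    (f \o (e \o D) : {linear _ -> _}).
- rewrite /=; have -> : D (diff Y (i + 1 + 1) x) = 0; last by rewrite !linear0.
  by apply/(pure_exact_elt Yp); exists x.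
- exact: df.
have [k kP] := C_pinj (complex_class X (j + 1 + 1)) Yp gd.
have le' : linear e' by move=> a x y; rewrite -{1}[x]e'e -{1}[y]e'e -linearP ee'.
exists (k \o lin le' : {linear _ -> _}) => x /=.
rewrite -[RHS](congr1 f (e'e x)).
apply: (DP _ (diff X (j + 1) \o k : {linear _ -> _}) (f \o e : {linear _ -> _})).
  exact: complex_class.
by move=> z; rewrite /= kP gP.
Qed.
End PureInjective.

(** * The theorem *)

Theorem mainTheorem3 (R : pzRingType) (R_noetherian : left_noetherian R)
    (n : nat) (M : 'I_n -> bimodule R)
    (M_fg : forall j, finitely_generated (left_mod (M j))) :
  (finite_pure_gldim R -> compactly_generated (K (Inj_of M))) /\
  ((forall j, flat (right_mod (M j))) ->
    (forall J : lmodType R, Inj_of M J -> injective_module J) /\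
    compactly_generated (K (Inj_of M))) /\
  compactly_generated (K (@injective_module R)).
Proof.
have env := Inj_of_preenvelopes M.
have Mdsum := Inj_of_dsum R_noetherian M_fg.
split; [|split].
- move=> gldim; apply: K_compactly_generated => // X Xfg.
  apply: pure_gldim_hom_exact gldim _; last exact: hom_fg_exact_pure.
  exact: Inj_of_pure_injective.
- move=> Mflat; have Minj := fun J => @Inj_of_injective R n M J Mflat.
  by split=> //; apply: K_compactly_generated => // X; exact: injective_hom_exact.
- apply: K_compactly_generated; [exact: dsum_injective | exact: injective_preenvelopes |].
  by move=> X; exact: injective_hom_exact.
Qed.
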